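(* Let $(\mathbf{x}_t)_{t\ge 0}$ be computed by the Stochastic Unified Momentum algorithm (described in the context) with momentum factor $\beta\in[0,1)$, parameter $s\ge 0$, stepsizes $(\gamma_t)_{t\ge0}$ and deterministic initial point $\mathbf{x}_0\in\mathbb{R}^d$. Suppose that assumptions (A.1)-(A.5) listed in the context hold and that the stepsizes satisfy (A.6), i.e. $(\gamma_t)_{t\ge0}$ is a deterministic nonnegative sequence with $\sum_{t=0}^\infty\gamma_t=\infty$ and $\sum_{t=0}^\infty\gamma_t^{1+\alpha}<\infty$. Then: (i) the sequence $f(\mathbf{x}_t)$ converges almost surely; (ii) the sequence $\nabla f(\mathbf{x}_t)$ converges to zero almost surely; (iii) if, in addition, $f$ has finitely many critical points in $\{\mathbf{x}\in\mathbb{R}^d: a\le f(\mathbf{x})\le b\}$ for any $a<b$, and $\lim_{\Vert\mathbf{x}\Vert\to\infty}f(\mathbf{x})=+\infty$, then $\mathbf{x}_t$ converges almost surely.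
   Context: $\Vert\cdot\Vert$ is the Euclidean norm on $\mathbb{R}^d$. $f:\mathbb{R}^d\to\mathbb{R}$ is the cost function. $\mathbf{g}(\mathbf{x},\xi)$ is a stochastic first order oracle: $\mathbf{g}$ is a Borel measurable $\mathbb{R}^d$-valued function, and $\xi_0,\xi_1,\dots$ are random variables on a probability space $(\Omega,\mathcal{F},\mathbb{P})$ with which the oracle is queried; write $\mathbf{g}_t=\mathbf{g}(\mathbf{x}_t,\xi_t)$. Stochastic Unified Momentum algorithm: given $\beta\in[0,1)$, $s\ge0$, $(\gamma_t)_{t\ge0}$ and $\mathbf{x}_0\in\mathbb{R}^d$, put $\mathbf{y}_0^s=\mathbf{x}_0$ and for $t=0,1,2,\dots$ $$\mathbf{y}_{t+1}=\mathbf{x}_t-\gamma_t\mathbf{g}_t,\qquad \mathbf{y}_{t+1}^s=\mathbf{x}_t-s\gamma_t\mathbf{g}_t,\qquad \mathbf{x}_{t+1}=\mathbf{y}_{t+1}+\beta(\mathbf{y}_{t+1}^s-\mathbf{y}_t^s).$$ Assumptions: (A.1) $f$ is continuously differentiable and $f_*:=\inf_{\mathbf{x}}f(\mathbf{x})>-\infty$. (A.2) There exist $\alpha\in(0,1]$ and $A>0$ such that $\Vert\nabla f(\mathbf{x})-\nabla f(\mathbf{y})\Vert\le A\Vert\mathbf{x}-\mathbf{y}\Vert^\alpha$ for all $\mathbf{x},\mathbf{y}\in\mathbb{R}^d$. (A.3) $\mathbb{E}[\mathbf{g}(\mathbf{x},\xi)]=\nabla f(\mathbf{x})$ for all $\mathbf{x}\in\mathbb{R}^d$,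 for $\xi$ each of the $\xi_t$. (A.4) There exist positive constants $\sigma^2$ and $C$ such that $\mathbb{E}[\Vert\mathbf{g}(\mathbf{x},\xi)-\nabla f(\mathbf{x})\Vert^2]\le\sigma^2+C\Vert\nabla f(\mathbf{x})\Vert^2$ for all $\mathbf{x}\in\mathbb{R}^d$, for $\xi$ each of the $\xi_t$. (A.5) The random variables $\{\xi_t\}_{t\ge0}$ are independent of each other. (A.6) $(\gamma_t)_{t\ge0}$ is a deterministic nonnegative sequence with $\sum_{t}\gamma_t=\infty$ and $\sum_{t}\gamma_t^{1+\alpha}<\infty$, with $\alpha$ as in (A.2). *)

(* Defs.v *)
From HB Require Import structures.
From mathcomp Require Export all_boot all_order all_algebra finmap.
From mathcomp Require Export all_classical all_reals all_analysis.

Set Implicit Arguments.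
Unset Strict Implicit.
Unset Printing Implicit Defensive.

Import Order.TTheory GRing.Theory Num.Theory.
Import numFieldNormedType.Exports.

Local Open Scope classical_set_scope.
Local Open Scope ring_scope.

(* The library norm of a row vector is the sup norm, so the Euclidean norm is
   defined here; both induce the same topology, hence the same notions of limit,
   continuity and differentiability. *)
Definition enorm (R : realType) (d : nat) (v : 'rV[R]_d) : R :=
  Num.sqrt (\sum_(i < d) v 0 i ^+ 2).

Definition gradient (R : realType) (d : nat) (f : 'rV[R]_d -> R)
    (x : 'rV[R]_d) : 'rV[R]_d :=
  \row_(i < d) 'D_(delta_mx 0 i) f x.

Definition continuously_differentiable (R : realType) (d : nat)
    (f : 'rV[R]_d -> R) : Prop :=
  (forall x, differentiable f x) /\ continuous (gradient f).

Definition bounded_below (R : realType) (d : nat) (f : 'rV[R]_d -> R) : Prop :=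
  (-oo < ereal_inf [set (f x)%:E | x in [set: 'rV[R]_d]])%E.

Definition holder_gradient (R : realType) (d : nat) (f : 'rV[R]_d -> R)
    (alpha : R) : Prop :=
  exists A : R, 0 < A /\
    forall x y, enorm (gradient f x - gradient f y) <= A * enorm (x - y) `^ alpha.

(* R^d with its Borel sigma-algebra. *)
Definition borelRV (R : realType) (d : nat) :=
  g_sigma_algebraType (@open 'rV[R]_d).

(* Joint measurability of the oracle; the sample space of the xi_t is an
   arbitrary measurable space. *)
Definition borel_oracle (R : realType) (d : nat) (dX : measure_display)
    (X : measurableType dX) (g : 'rV[R]_d -> X -> 'rV[R]_d) : Prop :=
  measurable_fun [set: borelRV R d * X]
    (fun p : borelRV R d * X => g p.1 p.2 : borelRV R d).

(* The expectation of a vector is taken coordinatewise. Integrability is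
   required explicitly because the library integral is total. *)
Definition unbiased (R : realType) (d : nat) (dO dX : measure_display)
    (Omega : measurableType dO) (X : measurableType dX)
    (P : probability Omega R) (g : 'rV[R]_d -> X -> 'rV[R]_d)
    (xi : nat -> {RV P >-> X}) (f : 'rV[R]_d -> R) : Prop :=
  forall (t : nat) (x : 'rV[R]_d) (i : 'I_d),
    P.-integrable [set: Omega] (fun w => (g x (xi t w) 0 i)%:E) /\
    ('E_P[fun w => (g x (xi t w) 0 i)%R])%E = (gradient f x 0 i)%:E.

Definition affine_variance (R : realType) (d : nat) (dO dX : measure_display)
    (Omega : measurableType dO) (X : measurableType dX)
    (P : probability Omega R) (g : 'rV[R]_d -> X -> 'rV[R]_d)
    (xi : nat -> {RV P >-> X}) (f : 'rV[R]_d -> R) : Prop :=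
  exists sigma2 C : R, [/\ 0 < sigma2, 0 < C &
    forall (t : nat) (x : 'rV[R]_d),
      ('E_P[fun w => (enorm (g x (xi t w) - gradient f x) ^+ 2)%R]
         <= (sigma2 + C * enorm (gradient f x) ^+ 2)%R%:E)%E].

Definition mutually_independent (R : realType) (dO dX : measure_display)
    (Omega : measurableType dO) (X : measurableType dX)
    (P : probability Omega R) (xi : nat -> {RV P >-> X}) : Prop :=
  forall (J : {fset nat}) (B : nat -> set X),
    (forall t, t \in J -> measurable (B t)) ->
    P (\bigcap_(t in [set` J]) (xi t @^-1` B t)) =
    (\prod_(t <- J) P (xi t @^-1` B t))%E.

Definition stepsizes (R : realType) (alpha : R) (gamma : nat -> R) : Prop :=
  [/\ forall t, 0 <= gamma t,
      (\sum_(0 <= t <oo) (gamma t)%:E = +oo)%E &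
      (\sum_(0 <= t <oo) (gamma t `^ (1 + alpha))%:E < +oo)%E].

(* Stochastic Unified Momentum: the pair (x_t, y^s_t) for one realization (z_t)
   of the noise. *)
Fixpoint sum_state (R : realType) (d : nat) (X : Type)
    (g : 'rV[R]_d -> X -> 'rV[R]_d) (beta s : R) (gamma : nat -> R)
    (x0 : 'rV[R]_d) (z : nat -> X) (t : nat) : 'rV[R]_d * 'rV[R]_d :=
  if t is t'.+1 then
    let (x, ys) := sum_state g beta s gamma x0 z t' in
    let gt := g x (z t') in
    let y' := x - gamma t' *: gt in
    let ys' := x - (s * gamma t') *: gt in
    (y' + beta *: (ys' - ys), ys')
  else (x0, x0).

Definition sum_iterate (R : realType) (d : nat) (X : Type)
    (g : 'rV[R]_d -> X -> 'rV[R]_d) (beta s : R) (gamma : nat -> R)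
    (x0 : 'rV[R]_d) (z : nat -> X) (t : nat) : 'rV[R]_d :=
  (sum_state g beta s gamma x0 z t).1.

Definition finitely_many_critical_points (R : realType) (d : nat)
    (f : 'rV[R]_d -> R) : Prop :=
  forall a b : R, a < b ->
    finite_set [set x | a <= f x <= b /\ gradient f x = 0].

Definition coercive (R : realType) (d : nat) (f : 'rV[R]_d -> R) : Prop :=
  forall M : R, exists r : R, forall x, r < enorm x -> M < f x.

(* Main.v *)
From HB Require Import structures.
Require Import Defs.
From mathcomp Require Import ring lra measurable_realfun.

Set Implicit Arguments.
Unset Strict Implicit.
Unset Printing Implicit Defensive.

Import Order.TTheory GRing.Theory Num.Theory.
Import numFieldNormedType.Exports.

Local Open Scope classical_set_scope.
Local Open Scope ring_scope.

(** Put [m_t = x_t - y^s_t], [u_t = (x_t - beta y^s_t) / (1 - beta)], [eta_t = gamma_t / (1 - beta)]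
    and [q = 1 + alpha]. Then [u_{t+1} = u_t - eta_t g_t] is plain stochastic descent, [m_{t+1} =
    beta m_t + (s (1 - beta) - 1) gamma_t g_t] is a contraction up to a small kick, and [u_t - x_t]
    is a multiple of [m_t]. Let [n_t] be the sum over [k < t] of [eta_k (g_k - grad f(x_k))], the
    accumulated noise.

    Probabilistic half. For a fixed vector [e] and scalar [c], let [V_t = f(u_t) - fs + |m_t|^q +
    (<e, n_t> + c)^2], with [fs] a lower bound of [f]. Once [gamma_t] is small, the conditional mean
    of [V_{t+1}] plus [D_t = eta_t/4 |grad f(x_t)|^2 + (1 - beta)/2 |m_t|^q] is at most
    [V_t + K gamma_t^q] ([lyapunov_pointwise], [lyapunov_drift]). The errors are summable, so almost
    surely [V_t] converges and the series of [D_t] converges ([supermartingale_cvg],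
    [direction_cvg]). The square is part of [V_t] because the variance bound grows with the
    gradient, so [n_t] is not known beforehand to be bounded in L2; subtracting the limits for
    [c = 1] and [c = 0] with [e] a basis vector shows that each coordinate of [n_t] converges.

    Deterministic half. On such a path [m_t] tends to 0, [f(u_t)] converges and [n_t] has a limit
    [n_oo]. The sequence [v_t = u_t + n_t - n_oo] obeys the noiseless recursion
    [v_{t+1} = v_t - eta_t grad f(x_t)], and [v_t - x_t] tends to 0. As [eta_t] is not summable but
    [eta_t |grad f(x_t)|^2] is, the gradient is small infinitely often; by Hoelder continuity a
    later excursion away from 0 would need a path length that the convergent series no longer
    affords ([excursions_vanish]). Then [f(x_t) - f(u_t)] tends to 0, which gives the convergence of
    values. Finally the steps of [x_t] vanish, and [x_t] approaches a finite set of critical points,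
    so it cannot leave the neighbourhood of one of them ([iterates_converge]). *)

(** * Euclidean inner product and norm on row vectors *)

Section euclidean.
Context {R : realType} {d : nat}.
Implicit Types u v w : 'rV[R]_d.

Definition dotp u v : R := \sum_(i < d) u 0 i * v 0 i.

Lemma dotpC u v : dotp u v = dotp v u.
Proof. by apply: eq_bigr => i _; rewrite mulrC. Qed.

Lemma dotpDr u v w : dotp u (v + w) = dotp u v + dotp u w.
Proof. by rewrite -big_split; apply: eq_bigr => i _; rewrite mxE mulrDr. Qed.

Lemma dotpZr a u v : dotp u (a *: v) = a * dotp u v.
Proof. by rewrite mulr_sumr; apply: eq_bigr => i _; rewrite mxE mulrCA. Qed.

Lemma dotpNr u v : dotp u (- v) = - dotp u v.
Proof. by rewrite -scaleN1r dotpZr mulN1r. Qed.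

Lemma dotpBr u v w : dotp u (v - w) = dotp u v - dotp u w.
Proof. by rewrite dotpDr dotpNr. Qed.

Lemma dotpBl u v w : dotp (u - v) w = dotp u w - dotp v w.
Proof. by rewrite dotpC dotpBr !(dotpC w). Qed.

Lemma dotpvv u : dotp u u = enorm u ^+ 2.
Proof.
rewrite sqr_sqrtr; first by apply: eq_bigr => i _; rewrite expr2.
by apply: sumr_ge0 => i _; rewrite sqr_ge0.
Qed.

Lemma enorm_ge0 u : 0 <= enorm u.
Proof. exact: sqrtr_ge0. Qed.

Lemma coord_enorm u i : `|u 0 i| <= enorm u.
Proof.
rewrite -sqrtr_sqr ler_wsqrtr// (bigD1 i)//= lerDl.
by apply: sumr_ge0 => j _; rewrite sqr_ge0.
Qed.

Lemma coord_sqr_enorm u i : u 0 i ^+ 2 <= enorm u ^+ 2.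
Proof. by rewrite -real_normK ?num_real// lerXn2r ?nnegrE ?enorm_ge0 ?coord_enorm. Qed.

Lemma enorm_eq0 u : enorm u = 0 -> u = 0.
Proof.
move=> u0; apply/rowP => i; rewrite mxE; apply/eqP.
by rewrite -normr_le0 -u0 coord_enorm.
Qed.

Lemma enorm0 : enorm (0 : 'rV[R]_d) = 0.
Proof. by rewrite /enorm big1 ?sqrtr0// => i _; rewrite mxE expr0n. Qed.

Lemma enormZ a u : enorm (a *: u) = `|a| * enorm u.
Proof.
rewrite /enorm -sqrtr_sqr -sqrtrM ?sqr_ge0// mulr_sumr; congr Num.sqrt.
by apply: eq_bigr => i _; rewrite mxE exprMn.
Qed.

Lemma enormN u : enorm (- u) = enorm u.
Proof. by rewrite -scaleN1r enormZ normrN1 mul1r. Qed.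

Lemma enormB u v : enorm (u - v) = enorm (v - u).
Proof. by rewrite -opprB enormN. Qed.

(** Expanding the square of the norm of [|v| u - |u| v] gives [2 |u| |v| (|u| |v| - <u, v>)], which
    is therefore nonnegative. *)
Lemma dotp_le u v : dotp u v <= enorm u * enorm v.
Proof.
have [u0|u0] := eqVneq (enorm u) 0.
  by rewrite u0 mul0r (enorm_eq0 u0) dotpC -(scale0r 0) dotpZr mul0r.
have [v0|v0] := eqVneq (enorm v) 0.
  by rewrite v0 mulr0 (enorm_eq0 v0) -(scale0r 0) dotpZr mul0r.
have uv : 0 < enorm u * enorm v by rewrite mulr_gt0// lt0r enorm_ge0 ?u0 ?v0.
have : 0 <= enorm (enorm v *: u - enorm u *: v) ^+ 2 by rewrite sqr_ge0.
rewrite -dotpvv dotpBr !dotpZr !dotpBl !(dotpC (_ *: _)) !dotpZr !dotpvv (dotpC v).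
rewrite [X in 0 <= X](_ : _ = 2 * (enorm u * enorm v) * (enorm u * enorm v - dotp u v)).
  by rewrite pmulr_rge0 ?subr_ge0// mulr_gt0.
ring.
Qed.

Lemma cauchy_schwarz u v : `|dotp u v| <= enorm u * enorm v.
Proof. by rewrite ler_norml dotp_le andbT lerNl -dotpNr -(enormN v) dotp_le. Qed.

Lemma enormD u v : enorm (u + v) <= enorm u + enorm v.
Proof.
rewrite -(@ler_pXn2r _ 2%N) ?nnegrE ?addr_ge0 ?enorm_ge0//.
rewrite -dotpvv dotpDr !(dotpC (_ + _)) !dotpDr !dotpvv (dotpC v).
by have := dotp_le u v; rewrite sqrrD; lra.
Qed.

Lemma ler_enorm_dist u v : `|enorm u - enorm v| <= enorm (u - v).
Proof.
have H (a b : 'rV[R]_d) : enorm a - enorm b <= enorm (a - b).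
  by rewrite lerBlDr -[X in enorm X <= _](subrK b) enormD.
by rewrite ler_norml H andbT lerNl opprB enormB H.
Qed.

Lemma enorm_sqrD u v : enorm (u + v) ^+ 2 <= 2 * enorm u ^+ 2 + 2 * enorm v ^+ 2.
Proof.
apply: le_trans (_ : (enorm u + enorm v) ^+ 2 <= _).
  by rewrite lerXn2r ?nnegrE ?addr_ge0 ?enorm_ge0 ?enormD.
have := sqr_ge0 (enorm u - enorm v); rewrite sqrrB sqrrD; lra.
Qed.

Lemma enorm_sum (I : Type) (r : seq I) (F : I -> 'rV[R]_d) :
  enorm (\sum_(i <- r) F i) <= \sum_(i <- r) enorm (F i).
Proof.
elim/big_ind2 : _ => [|x a y b xa yb|//]; first by rewrite enorm0.
exact: le_trans (enormD _ _) (lerD xa yb).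
Qed.

Lemma mxnorm_le_enorm u : `|u| <= enorm u.
Proof.
rewrite /Num.norm/= mx_normrE; apply: bigmax_le => [|[i j] _ /=]; first exact: enorm_ge0.
by rewrite (ord1 i) coord_enorm.
Qed.

Lemma coord_mxnorm u i : `|u 0 i| <= `|u|.
Proof. by rewrite [leRHS]/Num.norm/= mx_normrE; exact: (le_bigmax _ _ (0, i)). Qed.

Lemma enorm_le_mxnorm u : enorm u <= d%:R * `|u|.
Proof.
rewrite {1}(row_sum_delta u); apply: le_trans (enorm_sum _ _) _.
rewrite -[d in d%:R]card_ord -sum1_card natr_sum mulr_suml; apply: ler_sum => i _.
rewrite mul1r enormZ; apply: le_trans _ (coord_mxnorm u i).
rewrite -[leRHS]mulr1 ler_wpM2l// /enorm (bigD1 i)//= big1 => [|j ji].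
  by rewrite !mxE !eqxx expr1n addr0 sqrtr1.
by rewrite !mxE (negbTE ji) andbF expr0n.
Qed.

Lemma cvg_enorm0 (u : nat -> 'rV[R]_d) :
  (enorm (u n) @[n --> \oo] --> (0 : R)) <-> (u n @[n --> \oo] --> (0 : 'rV[R]_d)).
Proof.
split=> /cvgrPdist_lt u0; apply/cvgrPdist_lt => e e0.
  near=> n; rewrite sub0r normrN (le_lt_trans (mxnorm_le_enorm _))//.
  have : `|0 - enorm (u n)| < e by near: n; exact: u0.
  by rewrite sub0r normrN ger0_norm ?enorm_ge0.
(* The [+ 1] keeps the divisor positive when [d = 0]. *)
have d1 : 0 < (d%:R + 1 : R) by rewrite ltr_wpDl.
near=> n; rewrite sub0r normrN ger0_norm ?enorm_ge0//.
rewrite (le_lt_trans (enorm_le_mxnorm _))//.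
have : `|0 - u n| < e / (d%:R + 1) by near: n; apply: u0; rewrite divr_gt0.
rewrite sub0r normrN ltr_pdivlMr// => /le_lt_trans; apply.
by rewrite mulrC ler_wpM2l// lerDl.
Unshelve. all: by end_near. Qed.

Lemma continuous_enorm : continuous (@enorm R d).
Proof.
move=> u; have Fu := nbhs_filter u; apply/cvgrPdist_lt => e e0.
have d1 : 0 < (d%:R + 1 : R) by rewrite ltr_wpDl.
have : nbhs u [set v | `|u - v| < e / (d%:R + 1)].
  rewrite -[[set v | _]]/(ball_ Num.norm u _) ball_normE.
  by apply: nbhsx_ballx; rewrite divr_gt0.
apply: filterS => v /=; rewrite ltr_pdivlMr// => uv.
apply: le_lt_trans (ler_enorm_dist _ _) _.
rewrite (le_lt_trans (enorm_le_mxnorm _))// (le_lt_trans _ uv)//.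
by rewrite mulrC ler_wpM2l// lerDl.
Qed.

End euclidean.

(** * First-order Taylor estimate under a Hoelder gradient *)

Section descent.
Context {R : realType} {d : nat} (f : 'rV[R]_d -> R).
Hypothesis df : forall x, differentiable f x.

Lemma derive_gradient x v : 'D_v f x = dotp (gradient f x) v.
Proof.
rewrite deriveE// {1}(row_sum_delta v) linear_sum; apply: eq_bigr => i _.
by rewrite linearZ/= -deriveE// mxE mulrC.
Qed.

Lemma mean_value x v :
  exists2 c : R, 0 <= c <= 1 & f (x + v) - f x = dotp (gradient f (x + c *: v)) v.
Proof.
pose h (t : R) := f (x + t *: v).
have hd (t : R) : is_derive t 1 h (dotp (gradient f (x + t *: v)) v).
  have lin : is_diff t (cst x + *:%R ^~ v) (0 + *:%R ^~ v) by apply: is_diffD.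
  have fd : is_diff (x + t *: v) f ('d f (x + t *: v)) by apply: DiffDef.
  have [dh ddh] := is_diff_comp lin fd.
  apply: DeriveDef; first exact: diff_derivable.
  by rewrite deriveE// ddh/= -derive_gradient deriveE// add0r scale1r.
have [|c] := @MVT_segment R h (fun t => dotp (gradient f (x + t *: v)) v) 0 1
  ler01 (fun t _ => hd t).
  apply: continuous_subspaceT => t; apply: differentiable_continuous.
  by apply/derivable1_diffP; have [] := hd t.
rewrite in_itv/= /h scale1r scale0r addr0 subr0 mulr1 => c01 ?.
by exists c.
Qed.

(** The mean value theorem on the segment suffices; it yields the constant [A] instead of the
    sharper [A / (1 + alpha)], and only the order in [|v|] matters later. *)
Lemma descent (A alpha : R) x v : 0 <= A -> 0 <= alpha ->
  (forall x y, enorm (gradient f x - gradient f y) <= A * enorm (x - y) `^ alpha) ->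
  `|f (x + v) - f x - dotp (gradient f x) v| <= A * enorm v `^ (1 + alpha).
Proof.
move=> A0 a0 hA; have [c /andP[c0 c1] ->] := mean_value x v.
rewrite -dotpBl; apply: le_trans (cauchy_schwarz _ _) _.
have [->|v0] := eqVneq (enorm v) 0; first by rewrite mulr0 mulr_ge0// powR_ge0.
rewrite powRD ?v0 ?implybT// powRr1 ?enorm_ge0// mulrCA mulrC ler_wpM2l ?enorm_ge0//.
apply: le_trans (hA _ _) _; rewrite addrC addKr ler_wpM2l//.
rewrite ge0_ler_powR ?nnegrE ?enorm_ge0// enormZ ger0_norm// ler_piMl// enorm_ge0//.
Qed.

End descent.

(** * Measurability of vector-valued maps *)

Section row_measurability.
Context {R : realType} {d : nat}.

(** The coordinatewise form makes vector operations reduce to real ones; [borel_row_measurable] and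
    [row_measurable_borel] identify it with Borel measurability. *)
Definition row_measurable {dT} {T : measurableType dT} (h : T -> 'rV[R]_d) :=
  forall i, measurable_fun [set: T] (fun t => h t 0 i).

Lemma continuous_borelRV (h : 'rV[R]_d -> R) :
  continuous h -> measurable_fun [set: borelRV R d] h.
Proof.
move=> /continuousP ch; apply: (measurability _ (RGenOpens.measurableE R)).
move=> _ [_ [a [b ->] <-]]; rewrite setTI; apply: sub_sigma_algebra.
exact/ch/interval_open.
Qed.

Context {dT} {T : measurableType dT}.
Implicit Types h : T -> 'rV[R]_d.

Lemma borel_row_measurable h :
  measurable_fun [set: T] (h : T -> borelRV R d) -> row_measurable h.
Proof.
move=> mh i.
have mc : measurable_fun [set: borelRV R d] (fun v : 'rV[R]_d => v 0 i).
  by apply: continuous_borelRV => v; exact: coord_continuous.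
exact: measurableT_comp mc mh.
Qed.

(** An open set is the union of the countably many rational-centred cubes it contains, and the
    preimage of a cube is a finite intersection of coordinate events. *)
Lemma row_measurable_borel h :
  row_measurable h -> measurable_fun [set: T] (h : T -> borelRV R d).
Proof.
move=> mh; apply: (@measurability _ _ T (borelRV R d) setT h (@open 'rV[R]_d)) => // _ [U oU <-].
rewrite setTI.
pose box (q : 'rV[rat]_d) n := [set v : 'rV[R]_d |
  forall i, `|ratr (q 0 i) - v 0 i| < n.+1%:R^-1].
pose D := [set p : 'rV[rat]_d * nat | box p.1 p.2 `<=` (U : set 'rV[R]_d)].
have -> : h @^-1` U = \bigcup_(p in D) (h @^-1` box p.1 p.2).
  apply/seteqP; split=> [t /= Ut|t [p pD /= hp]]; last exact: pD.
  have /nbhs_ballP[e /= e0 eU] : nbhs (h t) U by apply: open_nbhs_nbhs.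
  (* Two points of one cube differ by less than twice its radius, hence the factor 2. *)
  have [n ne] : exists n, 2 * (n.+1%:R : R)^-1 < e.
    have e2 : 0 < e / 2 by rewrite divr_gt0.
    have [N _ HN] := near_infty_natSinv_lt (PosNum e2).
    by exists N; rewrite mulrC -ltr_pdivlMr//; apply: HN => /=.
  have /choice[q hq] (i : 'I_d) : exists q : rat, `|ratr q - h t 0 i| < n.+1%:R^-1.
    have : h t 0 i - n.+1%:R^-1 < h t 0 i + n.+1%:R^-1.
      by rewrite ltrBlDr -addrA ltrDl addr_gt0// invr_gt0.
    move=> /rat_in_itvoo[q]; rewrite in_itv/= => /andP[q1 q2]; exists q.
    by rewrite ltr_norml ltrBrDl q1 ltrBlDl q2.
  exists (\row_i q i, n) => [v /= bv|i]; last by rewrite mxE.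
  apply: eU; split => // k i; rewrite (ord1 k).
  have := bv i; have := hq i; rewrite mxE => h1 h2.
  rewrite /ball/= (le_lt_trans (ler_distD (ratr (q i)) _ _))// (lt_trans _ ne)//.
  by rewrite mulrDl mul1r distrC ltrD.
rewrite bigcup_mkcond; apply: countable_bigcupT_measurable => // -[q n].
case: ifP => // _.
rewrite [X in measurable X](_ : _ = \bigcap_(i in [set: 'I_d])
  ((fun t => h t 0 i) @^-1` [set r | `|ratr (q 0 i) - r| < n.+1%:R^-1])); last first.
  by apply/seteqP; split=> [t /= ht i _|t ht i]; [exact: ht|exact: ht].
apply: fin_bigcap_measurable => // i _; rewrite -[X in measurable X]setTI.
apply: (mh i) => //; exact: measurable_ball.
Qed.

Lemma row_measurable_cst (v : 'rV[R]_d) : row_measurable (fun _ : T => v).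
Proof. by move=> i; exact: measurable_cst. Qed.

Lemma row_measurableD h1 h2 : row_measurable h1 -> row_measurable h2 ->
  row_measurable (fun t => h1 t + h2 t).
Proof.
move=> m1 m2 i; under eq_fun do rewrite mxE.
exact: (measurable_funD (m1 i) (m2 i)).
Qed.

Lemma row_measurableZ (a : R) h : row_measurable h -> row_measurable (fun t => a *: h t).
Proof.
move=> m i; under eq_fun do rewrite mxE.
exact: (measurable_funM (measurable_cst a) (m i)).
Qed.

Lemma row_measurableB h1 h2 : row_measurable h1 -> row_measurable h2 ->
  row_measurable (fun t => h1 t - h2 t).
Proof.
move=> m1 m2 i; under eq_fun do rewrite !mxE.
exact: (measurable_funB (m1 i) (m2 i)).
Qed.

Lemma measurable_continuous_row (F : 'rV[R]_d -> R) h :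
  continuous F -> row_measurable h -> measurable_fun [set: T] (F \o h).
Proof.
move=> cF mh.
exact: (measurableT_comp (continuous_borelRV cF) (row_measurable_borel mh)).
Qed.

Lemma row_measurable_continuous (F : 'rV[R]_d -> 'rV[R]_d) h :
  continuous F -> row_measurable h -> row_measurable (F \o h).
Proof.
move=> cF mh i; apply: (@measurable_continuous_row (fun v => F v 0 i) h) => // v.
by apply: (@continuous_comp _ _ _ F (fun v => v 0 i)); [exact: cF|exact: coord_continuous].
Qed.

End row_measurability.

Lemma row_measurable_comp {R : realType} {d : nat} {d1 d2} {T1 : measurableType d1}
    {T2 : measurableType d2} (h : T2 -> 'rV[R]_d) (k : T1 -> T2) :
  row_measurable h -> measurable_fun [set: T1] k -> row_measurable (h \o k).
Proof. by move=> mh mk i; exact: (measurableT_comp (mh i) mk). Qed.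

(** * Upcrossings of a real sequence *)

Section upcrossings.
Context {R : realType}.
Implicit Types (w : nat -> R) (a b : R).

(** A trader's position: buy when the price is below [a], keep the asset while the price is at most
    [b], sell above [b]. *)
Fixpoint holding a b w (n : nat) : bool :=
  if n is n'.+1 then
    if holding a b w n' then w n <= b else w n < a
  else w 0 < a.

Definition upcrossed a b w n := holding a b w n && (b < w n.+1).

(** The trader's account counts the asset at its price while it is held, and at [a] otherwise.
    Selling above [b] releases at least [b - a], and buying below [a] only lowers the account. *)
Lemma upcrossing_gain a b w n : a < b ->
  (b - a) * (upcrossed a b w n)%:R + (if holding a b w n.+1 then w n.+1 else a)
  <= if holding a b w n then w n.+1 else a.
Proof.
move=> ab; rewrite /upcrossed /=.
case: (holding a b w n) => /=.
  by case: (ltP b (w n.+1)) => // h; rewrite ?mulr1 ?mulr0; lra.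
by rewrite mulr0 add0r; case: ifPn => // /ltW.
Qed.

(** At a dip below [a] after time [N] the trader holds; with no upcrossing left the position is kept
    forever, so the price never exceeds [b] again. *)
Lemma not_oscillating a b w N : a < b ->
  (forall n, (N <= n)%N -> ~~ upcrossed a b w n) ->
  (forall n, exists2 k, (n <= k)%N & w k < a) ->
  (forall n, exists2 k, (n <= k)%N & b < w k) -> False.
Proof.
move=> ab noup fa fb; have [n Nn wna] := fa N.+1.
have Hn : holding a b w n.
  case: n Nn wna => // n Nn wna /=; case: ifP => _ //.
  by rewrite (le_trans (ltW wna))// ltW.
have Hk k : holding a b w (n + k).
  elim: k => [|k IH]; first by rewrite addn0.
  rewrite addnS /= IH leNgt; apply/negP => bw.
  have /noup := leq_trans (ltnW Nn) (leq_addr k n).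
  by rewrite /upcrossed IH bw.
have [k nk bwk] := fb n.+1; have := Hk (k - n.+1)%N; have := Hk (k - n.+1).+1.
rewrite addnS/= -addSn subnKC// => + h; rewrite h leNgt => /negP.
by apply.
Qed.

Lemma frequently_lt w a : ~ (\forall n \near \oo, a <= w n) ->
  forall n, exists2 k, (n <= k)%N & w k < a.
Proof.
move=> h n; apply: contrapT => nk; apply: h; exists n => // k /= nk'.
by rewrite leNgt; apply/negP => wa; apply: nk; exists k.
Qed.

Lemma frequently_gt w a : ~ (\forall n \near \oo, w n <= a) ->
  forall n, exists2 k, (n <= k)%N & a < w k.
Proof.
move=> h n; apply: contrapT => nk; apply: h; exists n => // k /= nk'.
by rewrite leNgt; apply/negP => wa; apply: nk; exists k.
Qed.

(** The supremum of [S] is the lower limit of [w], finite because of [M]. If the upper limit were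
    larger, two rationals in between would be crossed infinitely often. *)
Lemma cvgn_upcrossed w M : (forall n, 0 <= w n) ->
  ~ (\forall n \near \oo, M <= w n) ->
  (forall p q : rat, 0 <= (ratr p : R) -> (ratr p : R) < ratr q ->
     exists N, forall n, (N <= n)%N -> ~~ upcrossed (ratr p) (ratr q) w n) ->
  cvgn w.
Proof.
move=> w0 wM up.
pose S := [set x | \forall n \near \oo, x <= w n].
have supS : has_sup S.
  split; first by exists 0; exists 0.
  exists M => x xS; rewrite leNgt; apply/negP => Mx; apply: wM.
  by apply: filterS xS => n; exact: le_trans (ltW Mx).
have S0 : 0 <= sup S by apply: ub_le_sup; [exact: supS.2|exists 0].
apply/cvg_ex; exists (sup S); apply/cvgrPdist_lt => e e0.
have [x xS xe] := sup_adherent e0 supS.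
have /rat_in_itvoo[p] : sup S < sup S + e / 2 by rewrite ltrDl divr_gt0.
rewrite in_itv/= => /andP[p1 p2].
have /rat_in_itvoo[q] : ratr p < sup S + e by rewrite (lt_trans p2)// ltrD2l; lra.
rewrite in_itv/= => /andP[pq q2].
have [N noup] := up p q (le_trans S0 (ltW p1)) pq.
have [wq|/frequently_gt fb] := pselect (\forall n \near \oo, w n <= ratr q); last first.
  exfalso; apply: (not_oscillating pq noup _ fb); apply: frequently_lt => pS.
  by have := ub_le_sup supS.2 pS; rewrite leNgt p1.
near=> n; rewrite ltr_distlC; apply/andP; split.
  by rewrite (lt_le_trans xe)//; near: n.
by rewrite (le_lt_trans _ q2)//; near: n.
Unshelve. all: by end_near. Qed.

End upcrossings.

(** * Almost sure convergence of nonnegative supermartingales with drift *)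

Section series_ae.
Context {d} {T : measurableType d} {R : realType} (P : probability T R).
Variable E : nat -> T -> R.
Hypothesis E0 : forall n w, 0 <= E n w.
Hypothesis mE : forall n, measurable_fun [set: T] (E n).

(** By monotone convergence the sum has integral at most [K] over [A], hence is finite almost
    everywhere there. *)
Lemma cvgn_series_ae (A : set T) (K : R) : measurable A ->
  (forall n, (\sum_(k < n) \int[P]_(w in A) (E k w)%:E <= K%:E)%E) ->
  {ae P, forall w, A w -> cvgn (series (E ^~ w))}.
Proof.
move=> mA EK; pose g w := (\sum_(n <oo) (E n w)%:E)%E.
have mEA n : measurable_fun A (EFin \o E n).
  by apply/measurable_EFinP; exact: measurable_funTS.
have g0 w : (0 <= g w)%E by apply: nneseries_ge0 => n _ _; rewrite lee_fin.
have mg : measurable_fun A g.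
  apply: (@ge0_emeasurable_sum _ _ _ A (fun n w => (E n w)%:E) xpredT) => [n w _ _|n _].
    by rewrite lee_fin.
  exact: mEA.
have ig : P.-integrable A g.
  apply/integrableP; split=> //.
  under eq_integral do rewrite gee0_abs//.
  rewrite integral_nneseries//; last by move=> n w _; rewrite lee_fin.
  apply: le_lt_trans (ltry K); apply: lime_le.
    by apply: is_cvg_nneseries => n _ _; apply: integral_ge0 => w _; rewrite lee_fin.
  by apply: nearW => n; rewrite big_mkord; exact: EK.
have := integrable_ae mA ig; apply: filterS => w /[apply] gfin.
apply: nondecreasing_is_cvgn.
  by apply/nondecreasing_seqP => n; rewrite seriesEnat /= big_nat_recr//= lerDl.
exists (fine (g w)) => _ [n _ <-]; rewrite -lee_fin fineK// seriesEnat/= -sumEFin.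
by apply: nneseries_lim_ge => k _ _; rewrite lee_fin.
Qed.

End series_ae.

Lemma measurable_coarser_set {d} {T : measurableType d} (G : set (set T)) (A : set T) :
  G `<=` measurable -> @measurable _ (g_sigma_algebraType G) A -> measurable A.
Proof. by move=> /(smallest_sub (@sigma_algebra_measurable _ T)); exact. Qed.

Lemma measurable_coarser {d d'} {T : measurableType d} {T' : measurableType d'}
    (G : set (set T)) (h : T -> T') : G `<=` measurable ->
  measurable_fun [set: g_sigma_algebraType G] (h : g_sigma_algebraType G -> T') ->
  measurable_fun [set: T] h.
Proof.
move=> Gm mh _ B mB; have := mh measurableT B mB; rewrite !setTI.
exact: measurable_coarser_set.
Qed.

Section supermartingale.
Context {d} {T : measurableType d} {R : realType} (P : probability T R).
Variable F : nat -> set (set T).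
Hypothesis Fm : forall n, F n `<=` measurable.
Hypothesis Fnd : forall n, F n `<=` F n.+1.
Notation FT n := (g_sigma_algebraType (F n)).
Variables W D : nat -> T -> R.
Hypothesis W0 : forall n w, 0 <= W n w.
Hypothesis D0 : forall n w, 0 <= D n w.
Hypothesis mW : forall n, measurable_fun [set: FT n] (W n : FT n -> R).
Hypothesis mD : forall n, measurable_fun [set: T] (D n).
(** The supermartingale inequality is tested on events of the past instead of using conditional
    expectations; integrability of [W] is not presupposed. *)
Hypothesis decr : forall n (A : set T), @measurable _ (FT n) A ->
  (\int[P]_(w in A) (W n.+1 w + D n w)%:E <= \int[P]_(w in A) (W n w)%:E)%E.

Let mono n (A : set T) : @measurable _ (FT n) A -> @measurable _ (FT n.+1) A.
Proof. by apply: sub_smallest2r; [exact: smallest_sigma_algebra|exact: Fnd]. Qed.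

Let mono0 n (A : set T) : @measurable _ (FT 0) A -> @measurable _ (FT n) A.
Proof. by move=> A0; elim: n => // n; exact: mono. Qed.

Let mWT n : measurable_fun [set: T] (W n).
Proof. exact: measurable_coarser (@Fm n) (@mW n). Qed.

Let decrW n (A : set T) : @measurable _ (FT n) A ->
  (\int[P]_(w in A) (W n.+1 w)%:E <= \int[P]_(w in A) (W n w)%:E)%E.
Proof.
move=> mA; apply: le_trans (decr mA); have mA' := measurable_coarser_set (@Fm n) mA.
apply: ge0_le_integral => // [w _|||w _]; rewrite ?lee_fin ?lerDl//.
- by apply/measurable_EFinP; exact: measurable_funTS.
- by apply/measurable_EFinP; apply: measurable_funTS; exact: measurable_funD.
Qed.

(** Since [W 0] may fail to be integrable, expectations are taken on these initial events, which
    exhaust the space as [N] grows. *)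
Let small N := [set w | W 0 w <= N%:R].

Let msmall N : @measurable _ (FT 0) (small N).
Proof.
rewrite (_ : small N = [set: T] `&` W 0 @^-1` `]-oo, N%:R]).
  exact: (@mW 0%N measurableT).
by rewrite setTI; apply/seteqP; split=> w; rewrite /small/= in_itv.
Qed.

Let small_bound N n :
  (\int[P]_(w in small N) (W n w)%:E + \sum_(k < n) \int[P]_(w in small N) (D k w)%:E
    <= N%:R%:E)%E.
Proof.
have mS : measurable (small N) := measurable_coarser_set (@Fm 0%N) (msmall N).
elim: n => [|n IH].
  rewrite big_ord0 adde0; apply: (@le_trans _ _ (\int[P]_(w in small N) (cst N%:R%:E w))%E).
    apply: ge0_le_integral => //; [|exact/measurable_EFinP/measurable_funTS].
    by move=> w _; rewrite lee_fin.
  by rewrite integral_cst// -[leRHS]mule1 lee_wpmul2l// ?lee_fin// probability_le1.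
apply: le_trans IH; rewrite big_ord_recr/= addeCA [leRHS]addeC leeD2l//.
rewrite -ge0_integralD//; last 4 first.
- by move=> w _; rewrite lee_fin.
- by apply/measurable_EFinP; exact: measurable_funTS.
- by move=> w _; rewrite lee_fin.
- by apply/measurable_EFinP; exact: measurable_funTS.
under eq_integral do rewrite -EFinD.
exact: decr (@mono0 n _ (msmall N)).
Qed.

Let ae_small (Q : T -> Prop) : (forall N, {ae P, forall w, small N w -> Q w}) ->
  {ae P, forall w, Q w}.
Proof.
move=> /ae_foralln; apply: filterS => w; apply.
exact/ltW/truncnS_gt.
Qed.

Let drift_summable : {ae P, forall w, cvgn (series (D ^~ w))}.
Proof.
apply: ae_small => N; apply: (cvgn_series_ae D0 mD (K := N%:R)) => [|n].
  exact: measurable_coarser_set (@Fm 0%N) (msmall N).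
apply: le_trans (small_bound N n); rewrite leeDr//.
by apply: integral_ge0 => w _; rewrite lee_fin.
Qed.

(** By Fatou the lower limit of [W n] is integrable on [small N], hence finite almost everywhere,
    which excludes divergence to infinity. *)
Let not_divergent : {ae P, forall w, exists M : R, ~ (\forall n \near \oo, M <= W n w)}.
Proof.
apply: ae_small => N.
have mS : measurable (small N) := measurable_coarser_set (@Fm 0%N) (msmall N).
have mWE n : measurable_fun (small N) (EFin \o W n).
  by apply/measurable_EFinP; exact: measurable_funTS.
have WE0 n w : small N w -> (0 <= (EFin \o W n) w)%E by rewrite /= lee_fin.
have fat := fatou P mS mWE WE0.
pose g w := limn_einf (fun n => (W n w)%:E).
have g0 w : (0 <= g w)%E.
  rewrite /g limn_einf_lim; apply: lime_ge; first exact: is_cvg_einfs.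
  apply: nearW => n; apply: le_ereal_inf_tmp => _ [k _ <-]; by rewrite lee_fin.
have ig : P.-integrable (small N) g.
  apply/integrableP; split.
    rewrite /g /limn_einf; apply: measurableT_comp => //.
    apply: (@measurable_fun_limn_esup _ _ _ (small N) (fun n w => - (W n w)%:E)%E) => n.
    by apply: measurableT_comp => //; exact: mWE.
  under eq_integral do rewrite gee0_abs//.
  apply: le_lt_trans fat _; apply: le_lt_trans (ltry N%:R).
  rewrite limn_einf_lim; apply: lime_le; first exact: is_cvg_einfs.
  apply: nearW => n; apply: le_trans (small_bound N n).
  apply: ereal_inf_le; exists (\int[P]_(w in small N) (W n w)%:E)%E; first by exists n => /=.
  by rewrite leeDl// sume_ge0// => k _; apply: integral_ge0 => w _; rewrite lee_fin.
have := integrable_ae mS ig; apply: filterS => w /[apply] gfin.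
apply: contrapT => h; have {}h M : \forall n \near \oo, M <= W n w.
  by apply: contrapT => h'; apply: h; exists M.
have : (W n w)%:E @[n --> \oo] --> +oo%E by apply/cvgeryP/cvgryPge.
by move=> /cvg_limn_einf_sup[gy _]; move: gfin; rewrite /g gy.
Qed.

Let mhold a b n : measurable_fun [set: FT n] (fun w : FT n => holding a b (W ^~ w) n).
Proof.
elim: n => [|n IH] /=.
  exact: measurable_fun_ltr (@mW 0%N) (measurable_cst _).
apply: measurable_fun_ifT.
- by move=> _ B mB; apply: mono; exact: IH.
- exact: measurable_fun_ler (@mW n.+1) (measurable_cst _).
- exact: measurable_fun_ltr (@mW n.+1) (measurable_cst _).
Qed.

Let mholdT a b n : measurable_fun [set: T] (fun w => holding a b (W ^~ w) n).
Proof. exact: measurable_coarser (@Fm n) (@mhold a b n). Qed.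

Let mup a b n : measurable_fun [set: T] (fun w => (b - a) * (upcrossed a b (W ^~ w) n)%:R).
Proof.
apply: measurable_funM => //.
rewrite (_ : (fun w => _) = fun w => if upcrossed a b (W ^~ w) n then 1 else 0); last first.
  by apply/funext => w; case: ifP.
apply: measurable_fun_ifT => //; apply: measurable_and; first exact: mholdT.
exact: measurable_fun_ltr.
Qed.

(** The trader's expected account never increases and starts at most at [a], so the total expected
    gain [b - a] per upcrossing is at most [a]. This holds on the whole space, without restricting
    to [small N]. *)
Let upcrossings_summable a b : 0 <= a -> a < b ->
  {ae P, forall w, exists N, forall n, (N <= n)%N -> ~~ upcrossed a b (W ^~ w) n}.
Proof.
move=> a0 ab.
pose U n w := (b - a) * (upcrossed a b (W ^~ w) n)%:R.
(* Position decided at time [n], valued at the price of time [m]: passing from [V n n] to [V n n.+1]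
   uses the supermartingale property, from [V n n.+1] to [V n.+1 n.+1] the pathwise gain. *)
pose V n m w := if holding a b (W ^~ w) n then W m w else a.
have U0 n w : 0 <= U n w by rewrite mulr_ge0// subr_ge0 ltW.
have V0 n m w : 0 <= V n m w by rewrite /V; case: ifP.
have mV n m : measurable_fun [set: T] (V n m).
  by apply: measurable_fun_ifT => //; exact: mholdT.
have step n : (\int[P]_w (U n w)%:E + \int[P]_w (V n.+1 n.+1 w)%:E
    <= \int[P]_w (V n n w)%:E)%E.
  rewrite -ge0_integralD//; last 4 first.
  - by move=> w _; rewrite lee_fin.
  - by apply/measurable_EFinP; exact: mup.
  - by move=> w _; rewrite lee_fin.
  - by apply/measurable_EFinP.
  apply: (@le_trans _ _ (\int[P]_w (V n n.+1 w)%:E)%E).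
    apply: ge0_le_integral => //.
    - by move=> w _; rewrite lee_fin addr_ge0.
    - by apply/measurable_EFinP; apply: measurable_funD => //; exact: mup.
    - by apply/measurable_EFinP.
    - by move=> w _; rewrite lee_fin; exact: upcrossing_gain.
  pose A := [set w | holding a b (W ^~ w) n].
  have mA : @measurable _ (FT n) A.
    rewrite -[X in measurable X]setTI; exact: (@mhold a b n measurableT [set true]).
  have mA' : measurable A := measurable_coarser_set (@Fm n) mA.
  have split_int m : (\int[P]_w (V n m w)%:E =
      \int[P]_(w in A) (W m w)%:E + \int[P]_(w in ~` A) a%:E)%E.
    rewrite -(setUv A) ge0_integral_setU//; last 4 first.
    - exact: measurableC.
    - by apply/measurable_EFinP; rewrite setUv.
    - by move=> w _; rewrite lee_fin.
    - by rewrite /disj_set setICr.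
    congr (_ + _)%E; apply: eq_integral => w; rewrite inE /A/= /V; first by move=> ->.
    by move=> /negP/negbTE ->.
  by rewrite !split_int leeD2r//; exact: decrW.
have bound n : (\sum_(k < n) \int[P]_w (U k w)%:E <= a%:E)%E.
  suff : (\sum_(k < n) \int[P]_w (U k w)%:E + \int[P]_w (V n n w)%:E <= a%:E)%E.
    apply: le_trans; rewrite leeDl//.
    by apply: integral_ge0 => w _; rewrite lee_fin.
  elim: n => [|n IH].
    rewrite big_ord0 add0e; apply: (@le_trans _ _ (\int[P]_w (cst a%:E w))%E).
      apply: ge0_le_integral => //; first by move=> w _; rewrite lee_fin.
        exact/measurable_EFinP.
      by move=> w _; rewrite lee_fin /V /=; case: ifP => // /ltW.
    by rewrite integral_cst// -[leRHS]mule1 lee_wpmul2l// ?lee_fin// probability_le1.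
  by apply: le_trans IH; rewrite big_ord_recr/= -addeA leeD2l.
have := cvgn_series_ae U0 (mup a b) measurableT bound; apply: filterS => w /(_ I).
(* The terms tend to 0 but take only the values 0 and [b - a], so they vanish eventually. *)
move=> /cvg_series_cvg_0 /cvgrPdist_lt /(_ (b - a)); rewrite subr_gt0 => /(_ ab)[N _ HN].
exists N => n Nn; apply/negP => up; have := HN n Nn.
by rewrite /U up mulr1 sub0r normrN ger0_norm ?subr_ge0 ?ltW// ltxx.
Qed.

Theorem supermartingale_cvg :
  {ae P, forall w, cvgn (W ^~ w) /\ cvgn (series (D ^~ w))}.
Proof.
(* Pairs of rationals are enumerated by [unpickle], so that a single null set serves all of them. *)
have up : {ae P, forall w, forall (n : nat) (p q : rat), choice.unpickle n = Some (p, q) ->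
    0 <= (ratr p : R) -> (ratr p : R) < ratr q ->
    exists N, forall n, (N <= n)%N -> ~~ upcrossed (ratr p) (ratr q) (W ^~ w) n}.
  apply: ae_foralln => n; case: (choice.unpickle n : option (rat * rat)) => [[p q]|]; last first.
    by apply: aeW.
  have [p0|p0] := leP 0 (ratr p : R); last first.
    by apply: aeW => w p1 q1 [<- _]; rewrite leNgt p0.
  have [pq|pq] := ltP (ratr p : R) (ratr q); last first.
    by apply: aeW => w p1 q1 [<- <-] _; rewrite ltNge pq.
  by apply: filterS (upcrossings_summable p0 pq) => w h p1 q1 [<- <-].
move: up not_divergent drift_summable; apply: filterS3 => w up [M nd] ds; split=> //.
apply: (cvgn_upcrossed (M := M)) => // p q.
by apply: (up (choice.pickle (p, q))); rewrite choice.pickleK.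
Qed.

End supermartingale.

(** * Integrating out a variable independent of the past *)

Section freezing.
Context {dO dX : measure_display} {Omega : measurableType dO} {X : measurableType dX}
  {R : realType} (P : probability Omega R) (xi : {RV P >-> X}) (G : set (set Omega)).
Notation GT := (g_sigma_algebraType G).
Hypothesis Gm : G `<=` measurable.
Hypothesis indep : forall (A : set Omega) (B : set X),
  @measurable _ GT A -> measurable B ->
  P (A `&` xi @^-1` B) = (P A * P (xi @^-1` B))%E.

(** The identity into the coarser space: its law is [P] restricted to the past. *)
Let id1 : Omega -> GT := id.
Let mid1 : measurable_fun [set: Omega] id1.
Proof.
move=> _ A mA; rewrite setTI.
exact: (smallest_sub (@sigma_algebra_measurable _ Omega) Gm mA).
Qed.
HB.instance Definition _ := isMeasurableFun.Build _ _ _ _ _ mid1.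

Let phi : Omega -> GT * X := fun w => (w, xi w).
Let mphi : measurable_fun [set: Omega] phi.
Proof. exact: (measurable_fun_pair mid1). Qed.
HB.instance Definition _ := isMeasurableFun.Build _ _ _ _ _ mphi.

(** By independence the joint law of the past and [xi] is a product measure, so Tonelli allows
    integrating over [xi] first with the past frozen. It replaces a bound on a conditional
    expectation. *)
Lemma freezing (h : GT * X -> \bar R) (u : Omega -> \bar R) (A : set Omega) :
  measurable_fun setT h -> (forall p, 0 <= h p)%E ->
  measurable_fun setT u -> @measurable _ GT A ->
  (forall w, \int[P]_w' h (w, xi w') <= u w)%E ->
  (\int[P]_(w in A) h (w, xi w) <= \int[P]_(w in A) u w)%E.
Proof.
move=> mh h0 mu mA hu.
have mAT : measurable (A `*` setT : set (GT * X)) by exact: measurableX.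
have joint (Z : set (GT * X)) : measurable Z ->
    distribution P phi Z = (distribution P id1 \x distribution P xi)%E Z.
  by move=> mZ; apply/esym/product_measure_unique.
have -> : (\int[P]_(w in A) h (w, xi w) =
    \int[distribution P phi]_(p in A `*` setT) h p)%E.
  rewrite ge0_integral_pushforward//; [|exact: measurable_funTS].
  by congr (integral _ _ _); apply/seteqP; split=> w //= [].
rewrite (@eq_measure_integral _ _ _ _ (distribution P id1 \x distribution P xi)%E); last first.
  by move=> Z mZ _; exact: joint.
rewrite integral_mkcond fubini_tonelli1//; last 2 first.
- by apply/(measurable_restrictT h mAT); exact: measurable_funTS.
- by move=> p; rewrite patchE; case: ifP.
have hxi w : (\int[distribution P xi]_y h (w, y) = \int[P]_w' h (w, xi w'))%E.
  by rewrite ge0_integral_distribution//; exact: measurableT_comp mh (pair1_measurable w).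
have mF : measurable_fun [set: GT] (fun w : GT => \int[P]_w' h (w, xi w'))%E.
  under eq_fun do rewrite -hxi.
  exact: measurable_fun_fubini_tonelli_F.
have F0 w : (0 <= \int[P]_w' h (w, xi w'))%E by exact: integral_ge0.
have mA' := smallest_sub (@sigma_algebra_measurable _ Omega) Gm mA.
apply: (@le_trans _ _ (\int[distribution P id1]_(w in A) \int[P]_w' h (w, xi w'))%E).
  rewrite [leRHS]integral_mkcond le_eqVlt; apply/orP; left; apply/eqP.
  apply: eq_integral => w _; rewrite /fubini_F patchE; case: ifPn => wA.
    rewrite -hxi; apply: eq_integral => y _; rewrite patchE.
    by rewrite in_setX wA in_setT.
  rewrite integral0_eq// => y _; rewrite patchE in_setX (negbTE wA)//.
rewrite ge0_integral_pushforward//; last exact: measurable_funTS.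
apply: ge0_le_integral => //; last by move=> w _; exact: hu.
- by move=> w _; exact: F0.
- by apply: measurable_funTS; exact: measurableT_comp mF mid1.
- exact: measurable_funTS.
Qed.

End freezing.

(** * The filtration generated by the noise variables *)

Section history.
Context {dO dX : measure_display} {Omega : measurableType dO} {X : measurableType dX}
  {R : realType} (P : probability Omega R) (xi : nat -> {RV P >-> X}).

(** Only the cylinders in [xi 0, ..., xi t.-1]: a pi-system generating the past before query [t],
    which is what the uniqueness theorem for measures needs. *)
Definition history (t : nat) : set (set Omega) :=
  [set A | exists2 B : nat -> set X, (forall k, measurable (B k)) &
     A = \bigcap_(k in `I_t) (xi k @^-1` B k)].

Lemma history_measurable t : history t `<=` measurable.
Proof.
move=> _ [B mB ->]; apply: bigcap_measurableType => k _.
rewrite -[X in measurable X]setTI; exact: (@measurable_funP _ _ _ _ setT (xi k) measurableT).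
Qed.

Lemma history_nondecreasing t : history t `<=` history t.+1.
Proof.
move=> _ [B mB ->]; exists (fun k => if (k < t)%N then B k else setT).
  by move=> k; case: ifP.
apply/seteqP; split=> w h k /= kt; first by case: ifPn => // kt'; exact: h.
by have := h k (ltnW kt); rewrite /= kt.
Qed.

Lemma history_setI t : setI_closed (history t).
Proof.
move=> _ _ [B mB ->] [C mC ->]; exists (fun k => B k `&` C k).
  by move=> k; exact: measurableI.
rewrite -bigcapI; apply: eq_bigcapr => k _; exact: preimage_setI.
Qed.

Lemma measurable_history t k : (k < t)%N ->
  measurable_fun [set: g_sigma_algebraType (history t)]
    (xi k : g_sigma_algebraType (history t) -> X).
Proof.
move=> kt _ B mB; rewrite setTI; apply: sub_sigma_algebra.
exists (fun j => if j == k then B else setT); first by move=> j; case: ifP.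
apply/seteqP; split=> w /=; last by move=> /(_ k kt); rewrite /= eqxx.
by move=> Bw j _ /=; case: eqP => // ->.
Qed.

Hypothesis indep : mutually_independent xi.

(** As functions of [A], both sides are finite measures; they agree on cylinders by mutual
    independence, hence on the generated sigma-algebra. *)
Lemma history_independent t (A : set Omega) (B : set X) :
  @measurable _ (g_sigma_algebraType (history t)) A -> measurable B ->
  P (A `&` xi t @^-1` B) = (P A * P (xi t @^-1` B))%E.
Proof.
move=> mA mB; set C := xi t @^-1` B.
have mC : measurable C.
  rewrite -[X in measurable X]setTI.
  exact: (@measurable_funP _ _ _ _ setT (xi t) measurableT).
have PC : P C = (fine (P C))%:E by rewrite fineK// fin_num_measure.
have PC0 : 0 <= fine (P C) by exact/fine_ge0/measure_ge0.
rewrite PC muleC.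
pose m1 := mrestr P mC; pose m2 := mscale (NngNum PC0) P.
apply: (@g_sigma_algebra_measure_unique _ _ _ (history t) (@history_measurable t)
  (fun=> setT) _ _ m1 m2) => //.
- by exists (fun=> setT) => //; apply/seteqP; split.
- by rewrite bigcup_const.
- exact: history_setI.
- move=> _ [D mD ->]; transitivity (P C * P (\bigcap_(k in `I_t) (xi k @^-1` D k)))%E; last by rewrite /m2/= /mscale/= -PC.
  rewrite /m1/= /mrestr.
  (* One family serves the product formula over both [J] and [J] with [t] added. *)
  pose E k := if k == t then B else D k.
  have mE k : measurable (E k) by rewrite /E; case: ifP.
  pose J := [fset k in iota 0 t]%fset.
  have inJ k : (k \in J) = (k < t)%N by rewrite !inE mem_iota.
  have EJ : \bigcap_(k in [set` J]) (xi k @^-1` E k) =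
      \bigcap_(k in `I_t) (xi k @^-1` D k).
    apply/seteqP; split=> w h k /= kt.
      by have := h k; rewrite /= inJ /E => /(_ kt); rewrite (ltn_eqF kt).
    by move: kt; rewrite inJ /E => kt; rewrite (ltn_eqF kt); exact: h.
  have EtJ : \bigcap_(k in [set` (t |` J)%fset]) (xi k @^-1` E k) =
      \bigcap_(k in `I_t) (xi k @^-1` D k) `&` C.
    rewrite -EJ; apply/seteqP; split=> w /=.
      move=> h; split=> [k /= kJ|]; first by apply: h; rewrite /= in_fset1U kJ orbT.
      by have := h t; rewrite /= in_fset1U eqxx /E eqxx; exact.
    move=> [h Cw] k /=; rewrite in_fset1U => /orP[/eqP ->|]; last exact: h.
    by rewrite /E eqxx.
  rewrite -EtJ -EJ !(@indep _ E (fun k _ => mE k)) big_fsetU1/=; last by rewrite inJ ltnn.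
  by rewrite /E eqxx.
- by rewrite /m1/= /mrestr setTI ltey_eq fin_num_measure.
Qed.

End history.

Lemma lerPdist_powR {R : realType} (A e alpha : R) : 0 < A -> 0 < e -> 0 < alpha ->
  exists2 tau : R, 0 < tau & A * tau `^ alpha <= e.
Proof.
move=> A0 e0 a0; exists ((e / A) `^ alpha^-1); first by rewrite powR_gt0// divr_gt0.
rewrite -powRrM mulVf ?gt_eqF// powRr1; last by rewrite divr_ge0 ?ltW.
by rewrite mulrC divfK ?gt_eqF.
Qed.

(** * Deterministic argument: small steps and finite energy force the gradient to vanish *)

Section excursions.
Context {R : realType}.
Variables (p h eta : nat -> R) (A alpha : R).
Hypotheses (A0 : 0 < A) (alpha0 : 0 < alpha).
Hypotheses (h0 : forall t, 0 <= h t) (eta0 : forall t, 0 <= eta t).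
Hypothesis ph : forall s t, (s <= t)%N ->
  `|p t - p s| <= A * (\sum_(s <= k < t) eta k * h k) `^ alpha.
Hypothesis ph0 : (p t - h t) @[t --> \oo] --> 0.
Hypothesis etacvg : eta @ \oo --> 0.
Hypothesis etah : cvgn (series (fun t => eta t * h t ^+ 2)).
Hypothesis etaoo : ~ cvgn (series eta).

(** Otherwise [eta t <= eta t * h t ^+ 2 / e ^+ 2] from [N] on, and the series of [eta] would
    converge. *)
Let frequently_small e N : 0 < e -> exists2 n, (N <= n)%N & h n < e.
Proof.
move=> e0; apply: contrapT => hN; apply: etaoo.
apply: nondecreasing_is_cvgn.
  by apply/nondecreasing_seqP => n; rewrite !seriesEnat /= big_nat_recr//= lerDl.
have nd : nondecreasing_seq (series (fun t => eta t * h t ^+ 2)).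
  apply/nondecreasing_seqP => n; rewrite !seriesEnat /= big_nat_recr//= lerDl.
  by rewrite mulr_ge0// sqr_ge0.
exists (series eta N + (e ^+ 2)^-1 * limn (series (fun t => eta t * h t ^+ 2))).
move=> _ [n _ <-].
apply: (@le_trans _ _ (series eta N + (e ^+ 2)^-1 * series (fun t => eta t * h t ^+ 2) n)).
  have e2 : 0 <= (e ^+ 2)^-1 by rewrite invr_ge0 sqr_ge0.
  elim: n => [|n IH].
    rewrite [in leLHS]/series/= big_geq// addr_ge0 ?mulr_ge0//.
      by rewrite /series/= sumr_ge0.
    by rewrite /series/= big_geq.
  have [nN|Nn] := ltnP n N.
    rewrite ler_wpDr//.
      by rewrite mulr_ge0// /series/= sumr_ge0// => k _; rewrite mulr_ge0// sqr_ge0.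
    rewrite /series/= [leRHS](@big_cat_nat _ _ _ n.+1)//= lerDl.
    by rewrite sumr_ge0.
  rewrite !seriesSr mulrDr addrA lerD// mulrCA ler_peMr//.
  have hn : e <= h n by rewrite leNgt; apply/negP => hne; apply: hN; exists n.
  rewrite ler_pdivlMl ?exprn_gt0// mulr1.
  by rewrite lerXn2r// ?nnegrE// (ltW e0).
rewrite lerD2l ler_wpM2l ?invr_ge0 ?sqr_ge0//.
exact: nondecreasing_cvgn_le.
Qed.

(** Start late, at a time with [h < e]. Since the last time [p] was at most [2 e], one has [h > e],
    so the path length is bounded by the first step plus the energy divided by [e], together at most
    [tau]. Hence [p] has risen by at most [e], and [h < p + e <= 4 e]. *)
Lemma excursions_vanish : h @ \oo --> 0.
Proof.
apply/cvgrPdist_lt => e' e'0; pose e := e' / 4.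
have e0 : 0 < e by rewrite divr_gt0.
have [tau tau0 Atau] := lerPdist_powR A0 e0 alpha0.
have [N1 _ HN1] : \forall t \near \oo, `|0 - (p t - h t)| < e.
  by move/cvgrPdist_lt : ph0; exact.
have t1 : 0 < tau / (6 * e) by rewrite divr_gt0// mulr_gt0.
have [N2 _ HN2] : \forall t \near \oo, `|0 - eta t| < tau / (6 * e).
  by move/cvgrPdist_lt : etacvg; exact.
have t2 : 0 < e * tau / 2 by rewrite divr_gt0// mulr_gt0.
have [N3 HN3] : exists N3, forall m n, (N3 <= m)%N -> (m <= n)%N ->
    \sum_(m <= k < n) eta k * h k ^+ 2 <= e * tau / 2.
  have /cauchy_cvgP/cauchy_seriesP/(_ _ t2) := etah.
  case=> -[/= B C] [[b _ Bb] [c _ Cc]] BC; exists (maxn b c) => m n; rewrite geq_max.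
  move=> /andP[bm cm] mn; have := BC (m, n) (conj (Bb m bm) (Cc n (leq_trans cm mn))).
  by rewrite /= => /ltW; apply: le_trans; exact: ler_norm.
have [N Nmax hN] := frequently_small (maxn N1 (maxn N2 N3)) e0.
have NN1 t : (N <= t)%N -> `|p t - h t| < e.
  move=> Nt; have := HN1 t; rewrite /= sub0r normrN; apply.
  by rewrite (leq_trans _ Nt)// (leq_trans _ Nmax)// leq_maxl.
have NN2 t : (N <= t)%N -> eta t <= tau / (6 * e).
  move=> Nt; have := HN2 t; rewrite /= sub0r normrN ger0_norm// => H; apply/ltW/H.
  by rewrite (leq_trans _ Nt)// (leq_trans _ Nmax)// leq_max leq_maxl orbT.
have NN3 m n : (N <= m)%N -> (m <= n)%N ->
    \sum_(m <= k < n) eta k * h k ^+ 2 <= e * tau / 2.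
  move=> Nm; apply: HN3.
  by rewrite (leq_trans _ Nm)// (leq_trans _ Nmax)// !leq_max leqnn !orbT.
have last_low t : (N <= t)%N -> exists s, [/\ (N <= s <= t)%N, p s <= 2 * e &
    forall k, (s < k <= t)%N -> 2 * e < p k].
  elim: t => [|t IH].
    rewrite leqn0 => /eqP N0; exists 0%N; rewrite N0; split=> // [|k].
      by have := NN1 0%N; rewrite N0 => /(_ isT); rewrite ltr_norml; rewrite N0 in hN; lra.
    by case: k.
  rewrite leq_eqVlt => /predU1P[Nt|Nt].
    exists t.+1; rewrite -Nt leqnn; split=> // [|k].
      by have := NN1 N (leqnn N); rewrite ltr_norml; lra.
    by move=> /andP[/leq_trans H /H]; rewrite ltnn.
  have [pt|pt] := leP (p t.+1) (2 * e).
    exists t.+1; rewrite leqnn andbT; split=> // [|k]; first exact: ltnW.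
    by move=> /andP[/leq_trans H /H]; rewrite ltnn.
  have [s [/andP[Ns st] ps sk]] := IH Nt; exists s; split=> //.
    by rewrite Ns ltnW.
  move=> k /andP[skk]; rewrite leq_eqVlt => /predU1P[->//|kt].
  by apply: sk; rewrite skk.
have bound t : (N <= t)%N -> p t <= 3 * e.
  move=> Nt; have [s [/andP[Ns st] ps sk]] := last_low t Nt.
  have S0 : 0 <= \sum_(s <= k < t) eta k * h k.
    by apply: sumr_ge0 => k _; rewrite mulr_ge0.
  have S : \sum_(s <= k < t) eta k * h k <= tau.
    have [ts|ts] := leqP t s; first by rewrite big_geq// ltW.
    rewrite big_ltn//.
    (* At [s] itself [h] need not exceed [e], so this step is bounded by the smallness of [eta] and
       [h s <= 3 * e]. *)
    have hs : eta s * h s <= tau / 2.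
      have hs3 : h s <= 3 * e by have := NN1 s Ns; rewrite ltr_norml; lra.
      apply: (@le_trans _ _ (tau / (6 * e) * (3 * e))); first by rewrite ler_pM// NN2.
      by rewrite le_eqVlt; apply/orP; left; apply/eqP; field; rewrite gt_eqF.
    suff : \sum_(s.+1 <= k < t) eta k * h k <= tau / 2 by lra.
    have H2 := NN3 s.+1 t (leqW Ns) ts.
    rewrite -(ler_pM2l e0) [leRHS]mulrA (le_trans _ H2)//.
    rewrite mulr_sumr big_nat [leRHS]big_nat; apply: ler_sum => k kst.
    rewrite mulrCA expr2 ler_wpM2l// ler_wpM2r//.
    have Nk : (N <= k)%N by case/andP: kst => /ltnW/(leq_trans Ns).
    have pk : 2 * e < p k by apply: sk; case/andP: kst => -> /ltnW ->.
    by have := NN1 k Nk; rewrite ltr_norml; lra.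
  have := ph st; rewrite ler_norml => /andP[_].
  have : A * (\sum_(s <= k < t) eta k * h k) `^ alpha <= A * tau `^ alpha.
    by rewrite ler_wpM2l ?(ltW A0)// ge0_ler_powR ?nnegrE ?(ltW alpha0) ?(ltW tau0).
  by lra.
exists N => // t /= Nt; rewrite sub0r normrN ger0_norm//.
have := bound t Nt; have := NN1 t Nt; rewrite ltr_norml.
by rewrite /e; lra.
Qed.

End excursions.

(** * Application to the gradient along a perturbed descent sequence *)

Section gradient_flow.
Context {R : realType} {d : nat} (f : 'rV[R]_d -> R) (A alpha : R).
Hypotheses (A0 : 0 < A) (alpha0 : 0 < alpha).
Hypothesis holder : forall x y,
  enorm (gradient f x - gradient f y) <= A * enorm (x - y) `^ alpha.

Lemma holder_cvg0 (u v : nat -> 'rV[R]_d) :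
  enorm (u t - v t) @[t --> \oo] --> 0 ->
  enorm (gradient f (u t) - gradient f (v t)) @[t --> \oo] --> 0.
Proof.
move=> uv; apply/cvgrPdist_lt => e e0.
have e2 : 0 < e / 2 by rewrite divr_gt0.
have [tau tau0 Atau] := lerPdist_powR A0 e2 alpha0.
have [N _ HN] : \forall t \near \oo, `|0 - enorm (u t - v t)| < tau.
  by move/cvgrPdist_lt : uv; exact.
exists N => // t /= Nt; rewrite sub0r normrN ger0_norm ?enorm_ge0//.
have := HN t Nt; rewrite /= sub0r normrN ger0_norm ?enorm_ge0// => uvt.
apply: (@le_lt_trans _ _ (e / 2)); last by rewrite ltr_pdivrMr// ltr_pMr// ltr1n.
apply: le_trans (holder _ _) _; apply: le_trans Atau; rewrite ler_wpM2l ?(ltW A0)//.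
by rewrite ge0_ler_powR ?nnegrE ?enorm_ge0 ?(ltW alpha0) ?(ltW tau0) ?(ltW uvt).
Qed.

(** The excursion argument with [p] the gradient norm along [v] and [h] the one along [x]: the
    recursion bounds displacements of [v] by sums of [eta * h]. *)
Lemma gradient_vanishes (v x : nat -> 'rV[R]_d) (eta : nat -> R) :
  (forall t, 0 <= eta t) -> eta @ \oo --> 0 -> ~ cvgn (series eta) ->
  (forall t, v t.+1 = v t - eta t *: gradient f (x t)) ->
  enorm (v t - x t) @[t --> \oo] --> 0 ->
  cvgn (series (fun t => eta t * enorm (gradient f (x t)) ^+ 2)) ->
  enorm (gradient f (x t)) @[t --> \oo] --> 0.
Proof.
move=> eta0 etacvg etaoo vS vx etag.
apply: (@excursions_vanish _ (fun t => enorm (gradient f (v t))) _ eta A alpha) => //.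
- by move=> t; exact: enorm_ge0.
- move=> s t st; apply: le_trans (ler_enorm_dist _ _) _; apply: le_trans (holder _ _) _.
  have S0 : 0 <= \sum_(s <= k < t) eta k * enorm (gradient f (x k)).
    by apply: sumr_ge0 => k _; rewrite mulr_ge0 ?enorm_ge0.
  rewrite ler_wpM2l ?(ltW A0)// ge0_ler_powR ?nnegrE ?enorm_ge0 ?(ltW alpha0)//.
  elim: t st {S0} => [|t IH].
    by rewrite leqn0 => /eqP ->; rewrite subrr enorm0 big_geq.
  rewrite leq_eqVlt => /predU1P[->|st]; first by rewrite subrr enorm0 big_geq.
  rewrite big_nat_recr//= vS addrAC; apply: le_trans (enormD _ _) _.
  by rewrite enormN enormZ ger0_norm// lerD2r IH.
- apply/norm_cvg0P; apply: (@squeeze_cvgr _ _ _ _ (cst 0)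
    (fun t => enorm (gradient f (v t) - gradient f (x t)))).
  + by apply: nearW => t; rewrite /= normr_ge0 ler_enorm_dist.
  + exact: cvg_cst.
  + exact: holder_cvg0.
Qed.

End gradient_flow.

Lemma positive_lower_bound {R : realType} (s : seq R) :
  exists2 e : R, 0 < e & forall x, x \in s -> 0 < x -> e <= x.
Proof.
elim: s => [|a s [e e0 es]]; first by exists 1.
have [a0|a0] := ltP 0 a.
  exists (Num.min e a); first by rewrite lt_min e0.
  move=> x; rewrite inE ge_min => /predU1P[->|/es + x0]; first by rewrite lexx orbT.
  by move=> /(_ x0) ->.
exists e => // x; rewrite inE => /predU1P[->|/es//].
by rewrite ltNge a0.
Qed.

(** * Convergence of the iterates when critical points are isolated *)

Section isolated_limit_points.
Context {R : realType} {d : nat} (f : 'rV[R]_d -> R).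
Hypothesis cf : continuous f.
Hypothesis cg : continuous (gradient f).
Hypothesis finite_crit : finitely_many_critical_points f.
Hypothesis coerc : coercive f.
Variables (x : nat -> 'rV[R]_d) (l : R).
Hypothesis fx : f (x t) @[t --> \oo] --> l.
Hypothesis gx : enorm (gradient f (x t)) @[t --> \oo] --> 0.
Hypothesis dx : enorm (x t.+1 - x t) @[t --> \oo] --> 0.

Let Z := [set z | l - 1 <= f z <= l + 1 /\ gradient f z = 0].

(** By coercivity the sequence ends up in a ball. Removing from it the [e]-neighbourhoods of [Z]
    leaves a compact set on which [phi] has a positive minimum, whereas [phi (x t)] tends to 0. *)
Let near_critical e : 0 < e ->
  \forall t \near \oo, exists2 z, Z z & enorm (x t - z) < e.
Proof.
move=> e0; have [r hr] := coerc (l + 1).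
have l1 : \forall t \near \oo, enorm (x t) <= r.
  have [N _ HN] : \forall t \near \oo, `|l - f (x t)| < 1.
    by move/cvgrPdist_lt : fx; exact.
  exists N => // t /= /HN /=; rewrite ltr_norml => h; rewrite leNgt; apply/negP => /hr.
  by lra.
pose K := [set y | enorm y <= r /\ forall z, Z z -> e <= enorm (y - z)].
have closedK : closed K.
  rewrite (_ : K = @enorm R d @^-1` [set s | s <= r] `&`
    \bigcap_(z in Z) (fun y => enorm (y - z)) @^-1` [set s | e <= s]); last first.
    by apply/seteqP; split.
  apply: closedI.
    by apply: closed_comp => [y _|]; [exact: continuous_enorm|exact: closed_le].
  apply: closed_bigI => z _; apply: closed_comp => [y _|]; last exact: closed_ge.
  apply: (@continuous_comp _ _ _ (fun y : 'rV[R]_d => y - z) (@enorm R d)).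
    apply: (@continuousB _ _ _ id (cst z)); first exact: cvg_id.
    exact: cst_continuous.
  exact: continuous_enorm.
have compactK : compact K.
  apply: bounded_closed_compact => //; exists r; split; first exact: num_real.
  move=> M rM y [yr _]; apply: le_trans (mxnorm_le_enorm y) _.
  by rewrite (le_trans yr)// ltW.
have [K0|/set0P K0] := eqVneq K set0.
  apply: filterS l1 => t xr; apply: contrapT => h.
  suff : K (x t) by rewrite K0.
  split=> // z Zz; rewrite leNgt; apply/negP => xz; apply: h; by exists z.
pose phi y := `|f y - l| + enorm (gradient f y).
have cphi : continuous phi.
  have c1 : continuous (fun y => `|f y - l|).
    move=> y; apply: (@continuous_comp _ _ _ (fun y => f y - l) (fun r : R => `|r|)).
      by apply: (@continuousB _ _ _ f (cst l)); [exact: cf|exact: cst_continuous].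
    exact: norm_continuous.
  have c2 : continuous (fun y => enorm (gradient f y)).
    by move=> y; apply: (@continuous_comp _ _ _ (gradient f) (@enorm R d)); [exact: cg|exact: continuous_enorm].
  by move=> y; apply: (@continuousD _ _ _ _ _ y (c1 y) (c2 y)).
have [c cK cmin] := EVT_min_rV K0 compactK (continuous_subspaceT cphi).
have phic : 0 < phi c.
  rewrite lt0r; apply/andP; split; last by rewrite addr_ge0// enorm_ge0.
  apply/negP; rewrite paddr_eq0 ?enorm_ge0// normr_eq0 => /andP[/eqP fc /eqP gc].
  move: cK; rewrite inE => -[_ /(_ c)]; rewrite subrr enorm0 leNgt e0 => H.
  suff : false by []. apply: H; split; last exact: enorm_eq0.
  by apply/andP; lra.
have phix : phi (x t) @[t --> \oo] --> 0.
  rewrite -[X in _ --> X]addr0; apply: cvgD => //.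
  by apply/norm_cvg0P/subr_cvg0.
have [N _ HN] : \forall t \near \oo, `|0 - phi (x t)| < phi c.
  by move/cvgrPdist_lt : phix; exact.
apply: filterS2 l1 (ex_intro2 _ _ N I HN) => t xr /= pt; apply: contrapT => h.
have /cmin : x t \in K.
  rewrite inE; split=> // z Zz; rewrite leNgt; apply/negP => xz; apply: h; by exists z.
by rewrite leNgt -[phi (x t)]ger0_norm ?addr_ge0 ?enorm_ge0// -normrN -sub0r pt.
Qed.

(** [Z] is finite, so its points are [del] apart. Being within [del / 4] of [Z] with steps below
    [del / 4], the sequence cannot pass to another point of [Z]. *)
Lemma iterates_converge : cvgn x.
Proof.
have /finite_seqP[s Zs] : finite_set Z by apply: finite_crit; lra.
have [del del0 hdel] := positive_lower_bound [seq enorm (a - b) | a <- s, b <- s].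
have sep a b : Z a -> Z b -> enorm (a - b) < del -> a = b.
  rewrite Zs /= => sa sb ab; apply/eqP; apply: contraTT ab => ab.
  rewrite -leNgt; apply: hdel; first by apply/allpairsP; exists (a, b).
  rewrite lt0r enorm_ge0 andbT; apply: contra ab => /eqP/enorm_eq0/eqP.
  by rewrite subr_eq0.
have del4 : 0 < del / 4 by rewrite divr_gt0.
have [N1 _ HN1] := near_critical del4.
have [N2 _ HN2] : \forall t \near \oo, `|0 - enorm (x t.+1 - x t)| < del / 4.
  by move/cvgrPdist_lt : dx; exact.
pose N := maxn N1 N2.
have [z0 Zz0 xz0] := HN1 N (leq_maxl _ _).
have stay t : (N <= t)%N -> enorm (x t - z0) < del / 4.
  elim: t => [|t IH]; first by rewrite leqn0 => /eqP H; rewrite -(congr1 x H).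
  rewrite leq_eqVlt => /predU1P[<-//|Nt].
  have [z Zz xz] := HN1 t.+1 (leq_trans (leq_maxl _ _) (ltnW Nt)).
  rewrite (sep z0 z)//; have := IH Nt.
  have := HN2 t (leq_trans (leq_maxr _ _) Nt); rewrite /= sub0r normrN.
  rewrite ger0_norm ?enorm_ge0// => h1 h2.
  have -> : z0 - z = (x t.+1 - z) + (- (x t.+1 - x t)) + (- (x t - z0)).
    by rewrite !opprB !addrA; apply/rowP => i; rewrite !mxE; ring.
  have := enormD (x t.+1 - z + - (x t.+1 - x t)) (- (x t - z0)).
  have := enormD (x t.+1 - z) (- (x t.+1 - x t)); rewrite !enormN; lra.
apply/cvg_ex; exists z0; apply/subr_cvg0/cvg_enorm0/cvgrPdist_lt => e e0.
have ed : 0 < Num.min e (del / 4) by rewrite lt_min e0.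
have [N3 _ HN3] := near_critical ed.
exists (maxn N N3) => // t /=; rewrite geq_max => /andP[Nt N3t].
rewrite sub0r normrN ger0_norm ?enorm_ge0//.
have [z Zz] := HN3 t N3t; rewrite lt_min => /andP[xe xd].
rewrite -(sep z z0)//.
have -> : z - z0 = - (x t - z) + (x t - z0).
  by apply/rowP => i; rewrite !mxE; ring.
have := enormD (- (x t - z)) (x t - z0); rewrite enormN; have := stay t Nt; lra.
Qed.

End isolated_limit_points.

(** * Inequalities for real powers with exponents [alpha] and [1 + alpha] *)

Section powers.
Context {R : realType} (alpha : R).
Hypothesis halpha : 0 < alpha <= 1.

Let a0 : 0 < alpha. Proof. by case/andP: halpha. Qed.
Let a1 : alpha <= 1. Proof. by case/andP: halpha. Qed.

Lemma powR1D_le1sqr (y : R) : 0 <= y -> y `^ (1 + alpha) <= 1 + y ^+ 2.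
Proof.
move=> y0; have [y1|y1] := leP y 1.
  have : y `^ (1 + alpha) <= 1 `^ (1 + alpha).
    by rewrite ge0_ler_powR ?nnegrE// addr_ge0// ltW.
  by rewrite powR1; have := sqr_ge0 y; lra.
have : y `^ (1 + alpha) <= y `^ 2.
  by rewrite ler_powR ?(ltW y1)//; have := a1; lra.
by rewrite (powR_mulrn 2)//; lra.
Qed.

Lemma powR1D (y : R) : 0 <= y -> y `^ (1 + alpha) = y * y `^ alpha.
Proof.
move=> y0; have [->|y00] := eqVneq y 0.
  by rewrite mul0r powR0// gt_eqF// addr_gt0.
by rewrite powRD ?y00 ?implybT// powRr1.
Qed.

Lemma sqr_le_powR1D (y : R) : 0 <= y <= 1 -> y ^+ 2 <= y `^ (1 + alpha).
Proof.
case/andP=> y0 y1; rewrite powR1D// expr2 ler_wpM2l//.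
have [->|y00] := eqVneq y 0; first exact: powR_ge0.
by rewrite ger1_powR// lt0r y00 y0.
Qed.

(** If [m <= y], then [m^(2 alpha) <= m^alpha <= y^alpha]; otherwise [y = y^alpha y^(1 - alpha) <=
    y^alpha m^(1 - alpha)]. It splits the squared gradient error into a part absorbed by the
    momentum term and a summable part. *)
Lemma powR_mixed_le (y m : R) : 0 <= y <= 1 -> 0 <= m ->
  y * (m `^ alpha) ^+ 2 <= y `^ alpha * m `^ (1 + alpha) + y `^ (1 + alpha).
Proof.
move=> /andP[y0 y1] m0; have [my|ym] := leP m y.
  rewrite ler_wpDl ?mulr_ge0 ?powR_ge0// powR1D// ler_wpM2l//.
  have le1 : m `^ alpha <= 1.
    have : m `^ alpha <= 1 `^ alpha by rewrite ge0_ler_powR ?nnegrE ?(ltW a0)// (le_trans my).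
    by rewrite powR1.
  apply: (@le_trans _ _ (m `^ alpha)); first by rewrite expr2 ler_piMr// powR_ge0.
  by rewrite ge0_ler_powR ?nnegrE ?(ltW a0).
rewrite ler_wpDr ?powR_ge0// powR1D// expr2 !mulrA ler_wpM2r ?powR_ge0//.
have [->|y00] := eqVneq y 0; first by rewrite mul0r mulr_ge0// powR_ge0.
have yE : y = y `^ alpha * y `^ (1 - alpha).
  by rewrite -powRD ?y00 ?implybT// subrKC powRr1.
have m00 : m != 0 by rewrite gt_eqF// (le_lt_trans y0).
have mE : m = m `^ (1 - alpha) * m `^ alpha.
  by rewrite -powRD ?m00 ?implybT// subrK powRr1.
rewrite [in leLHS]yE [X in _ <= _ * X]mE mulrA ler_wpM2r ?powR_ge0// ler_wpM2l ?powR_ge0//.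
by rewrite ge0_ler_powR ?nnegrE ?subr_ge0// ltW.
Qed.

(** Convexity of the power at the points [x] and [y / (1 - b)]; the factor [b] in front of [x]
    survives exactly, which keeps the momentum contractive. *)
Lemma powR_convex_le (b x y : R) : 0 <= b < 1 -> 0 <= x -> 0 <= y ->
  (b * x + y) `^ (1 + alpha) <=
  b * x `^ (1 + alpha) + (1 - b) * (y / (1 - b)) `^ (1 + alpha).
Proof.
move=> /andP[b0 b1] x0 y0.
have b01 : 0 <= b <= 1 by rewrite b0 ltW.
have q1 : 1 <= 1 + alpha by rewrite lerDl ltW.
have b1' : 0 < 1 - b by rewrite subr_gt0.
have xI : x \in (`[0, +oo[%classic : set R) by rewrite inE/= in_itv/= andbT.
have yI : y / (1 - b) \in (`[0, +oo[%classic : set R).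
  by rewrite inE/= in_itv/= andbT divr_ge0// ltW.
have H := convex_powR q1 (Itv01 b0 (ltW b1)) xI yI.
rewrite convRE [X in X `^ _ <= _]convRE/= /unstable.onem in H.
by rewrite [X in (_ + X) `^ _]mulrC divfK ?gt_eqF in H.
Qed.

End powers.

(** * The Lyapunov function and its one-step drift *)

Section lyapunov.
Context {R : realType} {d : nat} (f : 'rV[R]_d -> R) (alpha beta s A fs : R).
Hypothesis halpha : 0 < alpha <= 1.
Hypothesis hbeta : 0 <= beta < 1.
Hypothesis A0 : 0 < A.
Hypothesis df : forall x, differentiable f x.
Hypothesis holder : forall x y,
  enorm (gradient f x - gradient f y) <= A * enorm (x - y) `^ alpha.
Variables (e : 'rV[R]_d) (c0 : R).

Definition inv1b := (1 - beta)^-1.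
Definition kick := s * (1 - beta) - 1.
Definition lag := beta * inv1b.
Local Notation q := (1 + alpha).

Definition lyapunov (u m n : 'rV[R]_d) : R :=
  f u - fs + enorm m `^ q + (dotp e n + c0) ^+ 2.

(** [Bcst] collects the coefficients of [gamma^q |g|^q] from the function and momentum steps, [Hcst]
    comes from replacing the gradient at [u] by that at [x], and [Ecst] from the square of the noise
    increment. *)
Definition Bcst := A * inv1b `^ q + (1 - beta) * (`|kick| * inv1b) `^ q.
Definition Hcst := inv1b / 2 * (A * lag `^ alpha) ^+ 2.
Definition Ecst := (inv1b * enorm e) ^+ 2.

Let ib0 : 0 < inv1b. Proof. by rewrite invr_gt0 subr_gt0; case/andP: hbeta. Qed.
Let b1 : 0 < 1 - beta. Proof. by rewrite subr_gt0; case/andP: hbeta. Qed.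
Let B0 : 0 <= Bcst.
Proof. by rewrite addr_ge0// mulr_ge0 ?powR_ge0// ltW. Qed.
Let E0 : 0 <= Ecst. Proof. exact: sqr_ge0. Qed.
Let a0 : 0 < alpha. Proof. by case/andP: halpha. Qed.

Lemma momentum_step (gam : R) (m g : 'rV[R]_d) : 0 <= gam ->
  enorm (beta *: m + (kick * gam) *: g) `^ q <=
  beta * enorm m `^ q + (1 - beta) * (`|kick| * inv1b) `^ q * (gam `^ q * enorm g `^ q).
Proof.
move=> g0; have [beta0 _] := andP hbeta.
have y0 : 0 <= `|kick| * gam * enorm g by rewrite !mulr_ge0// enorm_ge0.
apply: (@le_trans _ _ ((beta * enorm m + `|kick| * gam * enorm g) `^ q)).
  rewrite ge0_ler_powR ?nnegrE ?enorm_ge0 ?addr_ge0 ?mulr_ge0 ?enorm_ge0 ?(ltW a0)//.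
  apply: le_trans (enormD _ _) _.
  by rewrite !enormZ (ger0_norm beta0) normrM (ger0_norm g0).
apply: le_trans (powR_convex_le halpha hbeta (enorm_ge0 m) y0) _.
rewrite lerD2l -[leRHS]mulrA ler_wpM2l ?(ltW b1)//.
rewrite (_ : _ / _ = `|kick| * inv1b * (gam * enorm g)); last by rewrite /inv1b; ring.
by rewrite !powRM ?mulr_ge0 ?enorm_ge0 ?(ltW ib0)// lexx.
Qed.

(** The bound is arranged by degree in [g - G]: a constant term, a linear term whose mean will
    vanish, and a quadratic term controlled by the variance. The power [|g|^q] enters through
    [|g|^q <= 1 + |g|^2]. *)
Lemma lyapunov_pointwise (gam : R) (u m n g G : 'rV[R]_d) : 0 <= gam ->
  lyapunov (u - (gam * inv1b) *: g) (beta *: m + (kick * gam) *: g)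
    (n + (gam * inv1b) *: (g - G)) <=
  (f u - fs - gam * inv1b * dotp (gradient f u) G + beta * enorm m `^ q +
    (dotp e n + c0) ^+ 2 + Bcst * gam `^ q * (1 + 2 * enorm G ^+ 2)) +
  dotp (- (gam * inv1b) *: gradient f u + (2 * (gam * inv1b) * (dotp e n + c0)) *: e) (g - G) +
  (2 * Bcst * gam `^ q + Ecst * gam ^+ 2) * enorm (g - G) ^+ 2.
Proof.
move=> g0; have [beta0 _] := andP hbeta.
set eta := gam * inv1b; set de := g - G; set gq := gam `^ q.
have eta0 : 0 <= eta by rewrite mulr_ge0// ltW.
have gq0 : 0 <= gq by exact: powR_ge0.
have fstep : f (u - eta *: g) - f u + eta * dotp (gradient f u) g <=
    A * inv1b `^ q * (gq * enorm g `^ q).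
  have := descent df u (- (eta *: g)) (ltW A0) (ltW a0) holder.
  rewrite dotpNr dotpZr opprK enormN enormZ (ger0_norm eta0).
  rewrite /eta !powRM ?mulr_ge0 ?enorm_ge0 ?(ltW ib0)// -/gq.
  by move/(le_trans (ler_norm _)); lra.
have mstep := momentum_step m g g0.
have gE : g = de + G by rewrite subrK.
have gnorm : enorm g `^ q <= 1 + 2 * enorm de ^+ 2 + 2 * enorm G ^+ 2.
  apply: le_trans (powR1D_le1sqr halpha (enorm_ge0 g)) _.
  by rewrite -addrA lerD2l {1}gE enorm_sqrD.
have nstep : (dotp e (n + eta *: de) + c0) ^+ 2 <= (dotp e n + c0) ^+ 2 +
    2 * eta * (dotp e n + c0) * dotp e de + Ecst * gam ^+ 2 * enorm de ^+ 2.
  rewrite dotpDr dotpZr.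
  have : dotp e de ^+ 2 <= (enorm e * enorm de) ^+ 2.
    rewrite -real_normK ?num_real// lerXn2r ?nnegrE ?mulr_ge0 ?enorm_ge0//.
    exact: cauchy_schwarz.
  move=> /(ler_wpM2l (sqr_ge0 eta)).
  have -> : Ecst * gam ^+ 2 * enorm de ^+ 2 = eta ^+ 2 * (enorm e * enorm de) ^+ 2.
    by rewrite /Ecst /eta; ring.
  by rewrite !sqrrD; lra.
have dotE : dotp (- eta *: gradient f u + (2 * eta * (dotp e n + c0)) *: e) de =
    - eta * dotp (gradient f u) g + eta * dotp (gradient f u) G +
    2 * eta * (dotp e n + c0) * dotp e de.
  rewrite dotpC dotpDr !dotpZr !(dotpC de) /de dotpBr; ring.
have bigB : Bcst * gq * enorm g `^ q <= Bcst * gq * (1 + 2 * enorm de ^+ 2 + 2 * enorm G ^+ 2).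
  by rewrite ler_wpM2l// mulr_ge0.
have BE : Bcst * gq * enorm g `^ q = A * inv1b `^ q * (gq * enorm g `^ q) +
    (1 - beta) * (`|kick| * inv1b) `^ q * (gq * enorm g `^ q) by rewrite /Bcst; ring.
rewrite dotE /lyapunov.
move: fstep mstep nstep bigB; rewrite BE -/gq -/eta => h1 h2 h3 h4.
have := lerD (lerD h1 h2) (lerD h3 h4).
set X1 := (1 - beta) * _ * _; set X2 := A * inv1b `^ q * _; lra.
Qed.

(** Young's inequality leaves [- eta / 2 |G|^2]; one half of it pays for the noise terms
    proportional to [|G|^2], the other is the drift. Likewise half of the momentum loss
    [(1 - beta) |m|^q] absorbs the gradient error. What remains is of order [gam^q], as
    [gam ^+ 2 <= gam^q] for [gam <= 1]. *)
Lemma lyapunov_drift (sigma2 C gam : R) (u m n x : 'rV[R]_d) :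
  0 <= sigma2 -> 0 <= C -> 0 <= gam <= 1 ->
  u - x = lag *: m ->
  Hcst * gam `^ alpha <= (1 - beta) / 2 ->
  (2 * Bcst + (2 * Bcst + Ecst) * C) * gam `^ alpha <= inv1b / 4 ->
  (f u - fs - gam * inv1b * dotp (gradient f u) (gradient f x) + beta * enorm m `^ q +
    (dotp e n + c0) ^+ 2 + Bcst * gam `^ q * (1 + 2 * enorm (gradient f x) ^+ 2)) +
  (2 * Bcst * gam `^ q + Ecst * gam ^+ 2) * (sigma2 + C * enorm (gradient f x) ^+ 2) +
  (gam * inv1b / 4 * enorm (gradient f x) ^+ 2 + (1 - beta) / 2 * enorm m `^ q) <=
  lyapunov u m n + (Hcst + Bcst + (2 * Bcst + Ecst) * sigma2) * gam `^ q.
Proof.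
move=> s0 C0 g01 ux hH hG; have [beta0 _] := andP hbeta; have [g0 g1] := andP g01.
have kap0 : 0 <= lag by rewrite mulr_ge0// ltW.
set G := gradient f x; set eta := gam * inv1b; set gq := gam `^ q.
have eta0 : 0 <= eta by rewrite mulr_ge0// ltW.
have gq0 : 0 <= gq by exact: powR_ge0.
have gqE : gq = gam * gam `^ alpha by exact: powR1D.
pose D := enorm (gradient f u - G).
have hD : D <= A * lag `^ alpha * enorm m `^ alpha.
  apply: le_trans (holder _ _) _; rewrite ux enormZ (ger0_norm kap0).
  by rewrite powRM ?enorm_ge0// mulrA.
have D0 : 0 <= D by exact: enorm_ge0.
have hD2 : eta / 2 * D ^+ 2 <= Hcst * (gam `^ alpha * enorm m `^ q + gq).
  apply: (@le_trans _ _ (Hcst * (gam * (enorm m `^ alpha) ^+ 2))).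
    rewrite (_ : Hcst * _ = eta / 2 * (A * lag `^ alpha * enorm m `^ alpha) ^+ 2); last first.
      by rewrite /Hcst /eta; ring.
    rewrite ler_wpM2l ?divr_ge0 ?(ltW b1)// lerXn2r// nnegrE.
    by rewrite !mulr_ge0// ?powR_ge0// ltW.
  rewrite ler_wpM2l//; last exact: powR_mixed_le halpha _ _ g01 (enorm_ge0 m).
  by rewrite mulr_ge0 ?sqr_ge0// divr_ge0// ltW.
have hdot : - eta * dotp (gradient f u) G <= - eta / 2 * enorm G ^+ 2 + eta / 2 * D ^+ 2.
  have uG : dotp (gradient f u) G = dotp (gradient f u - G) G + enorm G ^+ 2.
    by rewrite dotpBl dotpvv subrK.
  have h1 : - dotp (gradient f u - G) G <= D * enorm G.
    by rewrite -dotpNr -(enormN G) dotp_le.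
  have h2 : D * enorm G <= D ^+ 2 / 2 + enorm G ^+ 2 / 2.
    by have := sqr_ge0 (D - enorm G); rewrite sqrrB; lra.
  have : eta * (- dotp (gradient f u - G) G) <= eta * (D ^+ 2 / 2 + enorm G ^+ 2 / 2).
    by rewrite ler_wpM2l// (le_trans h1).
  by rewrite uG; lra.
have mq0 : 0 <= enorm m `^ q by exact: powR_ge0.
have hm : Hcst * gam `^ alpha * enorm m `^ q <= (1 - beta) / 2 * enorm m `^ q.
  by rewrite ler_wpM2r.
have G20 : 0 <= enorm G ^+ 2 by exact: sqr_ge0.
have hgam : Ecst * gam ^+ 2 <= Ecst * gq by rewrite ler_wpM2l// sqr_le_powR1D.
have hs2 : Ecst * gam ^+ 2 * (sigma2 + C * enorm G ^+ 2) <= Ecst * gq * (sigma2 + C * enorm G ^+ 2).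
  by rewrite ler_wpM2r// addr_ge0// mulr_ge0.
have hG2 : (2 * Bcst + (2 * Bcst + Ecst) * C) * gq * enorm G ^+ 2 <= eta / 4 * enorm G ^+ 2.
  rewrite ler_wpM2r// gqE mulrCA /eta -mulrA ler_wpM2l//.
rewrite /lyapunov.
move: hdot hD2 hm hs2 hG2; set mq := enorm m `^ q; set G2 := enorm G ^+ 2.
set ga := gam `^ alpha; set D2 := D ^+ 2; set dd := dotp _ _.
set ee := (dotp e n + c0) ^+ 2; move: (f u) => fu.
lra.
Qed.

End lyapunov.

(** * Expectation bounds for one oracle query *)

Section oracle.
Context {R : realType} {d : nat} {dO dX : measure_display}
  {Omega : measurableType dO} {X : measurableType dX} (P : probability Omega R)
  (f : 'rV[R]_d -> R) (g : 'rV[R]_d -> X -> 'rV[R]_d) (xi : nat -> {RV P >-> X}).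
Hypothesis hg : borel_oracle g.
Hypothesis hunb : unbiased g xi f.
Variables sigma2 C : R.
Hypothesis hvar : forall (t : nat) (x : 'rV[R]_d),
  ('E_P[fun w => (enorm (g x (xi t w) - gradient f x) ^+ 2)%R]
     <= (sigma2 + C * enorm (gradient f x) ^+ 2)%R%:E)%E.

Lemma oracle_measurable {dT} {T : measurableType dT} (x : T -> 'rV[R]_d) (z : T -> X) :
  row_measurable x -> measurable_fun [set: T] z -> row_measurable (fun w => g (x w) (z w)).
Proof.
move=> mx mz; apply: borel_row_measurable.
exact: (measurableT_comp hg (measurable_fun_pair (row_measurable_borel mx) mz)).
Qed.

(** Unbiasedness kills the linear term and the variance bound controls the quadratic one; the query
    point [x] is fixed. *)
Lemma oracle_expectation_le t x (h : Omega -> R) (a c1 : R) (p : 'rV[R]_d) :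
  measurable_fun [set: Omega] h -> (forall w, 0 <= h w) -> 0 <= c1 ->
  (forall w, h w <= a + dotp p (g x (xi t w) - gradient f x) +
    c1 * enorm (g x (xi t w) - gradient f x) ^+ 2) ->
  (\int[P]_w (h w)%:E <= (a + c1 * (sigma2 + C * enorm (gradient f x) ^+ 2))%:E)%E.
Proof.
move=> mh h0 c10 hle; set G := gradient f x.
pose de w := g x (xi t w) - G.
have deE w i : de w 0 i = g x (xi t w) 0 i - G 0 i by rewrite /de mxE [X in _ + X]mxE.
have mde : row_measurable de.
  apply: row_measurableB; last exact: row_measurable_cst.
  apply: oracle_measurable; first exact: row_measurable_cst.
  exact: measurable_funP.
have ig i := (hunb t x i).1.
have icst (r : R) : P.-integrable [set: Omega] (fun _ => r%:E) by exact: finite_measure_integrable_cst.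
have intc (r : R) : (\int[P]_w r%:E = r%:E)%E.
  transitivity (r%:E * P setT)%E; first exact: integral_cst.
  by rewrite probability_setT mule1.
have ide i : P.-integrable [set: Omega] (fun w => (de w 0 i)%:E).
  have := integrableB measurableT (ig i) (icst (G 0 i)).
  by apply: eq_integrable => // w _; rewrite deE EFinB.
have de0 i : (\int[P]_w (de w 0 i)%:E = 0)%E.
  under eq_integral do rewrite deE EFinB.
  rewrite integralB//.
  have := (hunb t x i).2; rewrite unlock => ->.
  by rewrite intc -EFinB subrr.
have ipde i : P.-integrable [set: Omega] (fun w => (p 0 i * de w 0 i)%:E).
  have := integrableZl measurableT (p 0 i) (ide i).
  by apply: eq_integrable => // w _; rewrite EFinM.
have dotE w : (dotp p (de w))%:E = (\sum_(i < d) (p 0 i * de w 0 i)%:E)%E.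
  by rewrite sumEFin.
have idot : P.-integrable [set: Omega] (fun w => (dotp p (de w))%:E).
  under eq_fun do rewrite dotE.
  exact: integrable_sum.
have dot0 : (\int[P]_w (dotp p (de w))%:E = 0)%E.
  under eq_integral do rewrite dotE.
  rewrite integral_sum// big1// => i _.
  under eq_integral do rewrite EFinM.
  by rewrite integralZl// de0 mule0.
have msq : measurable_fun [set: Omega] (fun w => enorm (de w) ^+ 2).
  apply: measurable_funX; exact: (measurable_continuous_row continuous_enorm mde).
have hsq : (\int[P]_w (enorm (de w) ^+ 2)%:E <= (sigma2 + C * enorm G ^+ 2)%:E)%E.
  by have := hvar t x; rewrite unlock.
have isq : P.-integrable [set: Omega] (fun w => (enorm (de w) ^+ 2)%:E).
  apply/integrableP; split; first exact/measurable_EFinP.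
  under eq_integral do rewrite gee0_abs ?lee_fin ?sqr_ge0//.
  exact: le_lt_trans hsq (ltry _).
apply: (@le_trans _ _ (\int[P]_w (a%:E + (dotp p (de w))%:E + c1%:E * (enorm (de w) ^+ 2)%:E))%E).
  apply: ge0_le_integral => //.
  - by move=> w _; rewrite lee_fin.
  - exact/measurable_EFinP.
  - apply: emeasurable_funD.
      apply: emeasurable_funD => //; exact: measurable_int idot.
    exact/measurable_EFinP/measurable_funM.
  - by move=> w _; rewrite -EFinM -!EFinD lee_fin.
rewrite integralD//; last 2 first.
- exact: integrableD.
- exact: integrableZl.
rewrite integralD// dot0 adde0 integralZl//.
by rewrite intc EFinD EFinM leeD2l// lee_wpmul2l// lee_fin.
Qed.

End oracle.

Lemma stepsizes_series {R : realType} (alpha : R) (gamma : nat -> R) :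
  stepsizes alpha gamma ->
  ~ cvgn (series gamma) /\ cvgn (series (fun t => gamma t `^ (1 + alpha))).
Proof.
move=> [g0 goo gq]; split=> [cg|].
  have nd : nondecreasing_seq (series gamma).
    by apply/nondecreasing_seqP => n; rewrite seriesSr lerDl.
  have : (\sum_(0 <= t <oo) (gamma t)%:E <= (limn (series gamma))%:E)%E.
    apply: lime_le; first by apply: is_cvg_nneseries => n _ _; rewrite lee_fin.
    by apply: nearW => n; rewrite sumEFin lee_fin; exact: nondecreasing_cvgn_le.
  by rewrite goo leye_eq.
apply: nondecreasing_is_cvgn.
  by apply/nondecreasing_seqP => n; rewrite seriesSr lerDl powR_ge0.
have S0 : (0 <= \sum_(0 <= t <oo) (gamma t `^ (1 + alpha))%:E)%E.
  by apply: nneseries_ge0 => n _ _; rewrite lee_fin powR_ge0.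
exists (fine (\sum_(0 <= t <oo) (gamma t `^ (1 + alpha))%:E)) => _ [n _ <-].
rewrite -lee_fin fineK ?ge0_fin_numE// -sumEFin.
by apply: nneseries_lim_ge => k _ _; rewrite lee_fin powR_ge0.
Qed.

Lemma cvgn_series_shift {R : realType} (a : nat -> R) (N : nat) :
  cvgn (series (fun k => a (k + N)%N)) -> cvgn (series a).
Proof.
have sE n : series a (n + N)%N = series (fun k => a (k + N)%N) n + series a N.
  elim: n => [|n IH]; last by rewrite addSn !seriesSr IH addrAC.
  by rewrite [X in X + _]/series /= big_geq// add0r.
move=> /cvg_ex[l cl]; apply/cvg_ex; exists (l + series a N).
rewrite -(cvg_shiftn N); under eq_fun do rewrite sE.
by apply: cvgD => //; exact: cvg_cst.
Qed.

Lemma measurable_finer {d d'} {T : measurableType d} {T' : measurableType d'}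
    (G1 G2 : set (set T)) (h : T -> T') : G1 `<=` G2 ->
  measurable_fun [set: g_sigma_algebraType G1] (h : g_sigma_algebraType G1 -> T') ->
  measurable_fun [set: g_sigma_algebraType G2] (h : g_sigma_algebraType G2 -> T').
Proof.
move=> G12 mh _ B mB; have := mh measurableT B mB.
by apply: sub_smallest2r; [exact: smallest_sigma_algebra|exact: G12].
Qed.

(** * The random process and its supermartingale *)

Section process.
Context {R : realType} {d : nat} {dO dX : measure_display}
  {Omega : measurableType dO} {X : measurableType dX} (P : probability Omega R)
  (f : 'rV[R]_d -> R) (g : 'rV[R]_d -> X -> 'rV[R]_d) (xi : nat -> {RV P >-> X})
  (alpha beta s : R) (gamma : nat -> R) (x0 : 'rV[R]_d).
Hypothesis hg : borel_oracle g.
Hypothesis cg : continuous (gradient f).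
Hypothesis hbeta : 0 <= beta < 1.

Definition iterate (t : nat) (w : Omega) :=
  (sum_state g beta s gamma x0 (fun k => xi k w) t).1.
Definition auxiliary (t : nat) (w : Omega) :=
  (sum_state g beta s gamma x0 (fun k => xi k w) t).2.
Definition momentum t w := iterate t w - auxiliary t w.
(** The extrapolated point in whose recursion momentum cancels (see [shiftedS]). *)
Definition shifted t w := inv1b beta *: (iterate t w - beta *: auxiliary t w).
Definition query t w := g (iterate t w) (xi t w).
Definition noise t w :=
  \sum_(k < t) (gamma k * inv1b beta) *: (query k w - gradient f (iterate k w)).

Let b1 : 1 - beta != 0.
Proof. by rewrite subr_eq0 gt_eqF//; case/andP: hbeta. Qed.

Let iterateS t w : iterate t.+1 w = iterate t w - gamma t *: query t w +
  beta *: (iterate t w - (s * gamma t) *: query t w - auxiliary t w).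
Proof. by rewrite /query /iterate /auxiliary /=; case: (sum_state _ _ _ _ _ _ _). Qed.

Let auxiliaryS t w : auxiliary t.+1 w = iterate t w - (s * gamma t) *: query t w.
Proof. by rewrite /query /iterate /auxiliary /=; case: (sum_state _ _ _ _ _ _ _). Qed.

Lemma shiftedS t w :
  shifted t.+1 w = shifted t w - (gamma t * inv1b beta) *: query t w.
Proof.
rewrite /shifted iterateS auxiliaryS; apply/rowP => i; rewrite !mxE /inv1b.
by field; rewrite b1.
Qed.

Lemma momentumS t w :
  momentum t.+1 w = beta *: momentum t w + (kick beta s * gamma t) *: query t w.
Proof.
by rewrite /momentum iterateS auxiliaryS; apply/rowP => i; rewrite !mxE /kick; ring.
Qed.

Lemma noiseS t w : noise t.+1 w =
  noise t w + (gamma t * inv1b beta) *: (query t w - gradient f (iterate t w)).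
Proof. by rewrite /noise big_ord_recr. Qed.

Lemma shifted_iterate t w : shifted t w - iterate t w = lag beta *: momentum t w.
Proof.
rewrite /shifted /momentum; apply/rowP => i; rewrite !mxE /lag /inv1b.
by field; rewrite b1.
Qed.

Notation FT t := (g_sigma_algebraType (history xi t)).

Let finer t (h : Omega -> 'rV[R]_d) : @row_measurable R d _ (FT t) h ->
  @row_measurable R d _ (FT t.+1) h.
Proof. by move=> mh i; apply: measurable_finer (mh i); exact: history_nondecreasing. Qed.

Let state_measurable t :
  @row_measurable R d _ (FT t) (iterate t) /\ @row_measurable R d _ (FT t) (auxiliary t).
Proof.
elim: t => [|t [mx my]]; first by split; exact: row_measurable_cst.
have mx' := finer mx; have my' := finer my.
have mq : @row_measurable R d _ (FT t.+1) (query t).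
  exact: (oracle_measurable hg mx' (@measurable_history _ _ _ _ _ P xi _ _ (ltnSn t))).
have ma : @row_measurable R d _ (FT t.+1) (fun w => iterate t w - (s * gamma t) *: query t w).
  exact: (row_measurableB mx' (row_measurableZ _ mq)).
split.
  rewrite (_ : iterate t.+1 = fun w => iterate t w - gamma t *: query t w +
    beta *: (iterate t w - (s * gamma t) *: query t w - auxiliary t w)); last first.
    by apply/funext => w; exact: iterateS.
  apply: row_measurableD; first exact: (row_measurableB mx' (row_measurableZ _ mq)).
  exact: (row_measurableZ _ (row_measurableB ma my')).
rewrite (_ : auxiliary t.+1 = fun w => iterate t w - (s * gamma t) *: query t w)//.
by apply/funext => w; exact: auxiliaryS.
Qed.

Lemma iterate_measurable t : @row_measurable R d _ (FT t) (iterate t).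
Proof. by case: (state_measurable t). Qed.

Lemma momentum_measurable t : @row_measurable R d _ (FT t) (momentum t).
Proof. by case: (state_measurable t) => mx my; exact: (row_measurableB mx my). Qed.

Lemma shifted_measurable t : @row_measurable R d _ (FT t) (shifted t).
Proof.
case: (state_measurable t) => mx my.
exact: (row_measurableZ _ (row_measurableB mx (row_measurableZ _ my))).
Qed.

Lemma noise_measurable t : @row_measurable R d _ (FT t) (noise t).
Proof.
elim: t => [|t IH].
  rewrite (_ : noise 0%N = fun=> 0); first exact: row_measurable_cst.
  by apply/funext => w; rewrite /noise big_ord0.
rewrite (_ : noise t.+1 = fun w =>
  noise t w + (gamma t * inv1b beta) *: (query t w - gradient f (iterate t w))); last first.
  by apply/funext => w; exact: noiseS.
have mx := finer (@iterate_measurable t).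
have mq : @row_measurable R d _ (FT t.+1) (query t).
  exact: (oracle_measurable hg mx (@measurable_history _ _ _ _ _ P xi _ _ (ltnSn t))).
have mG := row_measurable_continuous cg mx.
exact: (row_measurableD (finer IH) (row_measurableZ _ (row_measurableB mq mG))).
Qed.

Hypothesis halpha : 0 < alpha <= 1.
Hypothesis df : forall x, differentiable f x.
Hypothesis hunb : unbiased g xi f.
Hypothesis indep : mutually_independent xi.
Variables sigma2 C A fs : R.
Hypotheses (sigma20 : 0 <= sigma2) (C0 : 0 <= C) (A0 : 0 < A).
Hypothesis fsf : forall x, fs <= f x.
Hypothesis hvar : forall (t : nat) (x : 'rV[R]_d),
  ('E_P[fun w => (enorm (g x (xi t w) - gradient f x) ^+ 2)%R]
     <= (sigma2 + C * enorm (gradient f x) ^+ 2)%R%:E)%E.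
Hypothesis holder : forall x y,
  enorm (gradient f x - gradient f y) <= A * enorm (x - y) `^ alpha.
Hypothesis gamma0 : forall t, 0 <= gamma t.
Hypothesis gammaq : cvgn (series (fun t => gamma t `^ (1 + alpha))).
Local Notation q := (1 + alpha).

Let a0 : 0 < alpha. Proof. by case/andP: halpha. Qed.

Let q0 : 0 < q. Proof. by rewrite addr_gt0. Qed.

Let gammaq_cvg : (fun t => gamma t `^ q) @ \oo --> (0 : R).
Proof. exact: cvg_series_cvg_0. Qed.

(** The terms [gamma t] to the power [q] of a convergent series tend to 0, and the power is
    monotone. *)
Lemma gamma_power_small (e : R) : 0 < e ->
  \forall t \near \oo, gamma t <= 1 /\ gamma t `^ alpha <= e.
Proof.
move=> e0; pose e1 := Num.min 1 (e `^ alpha^-1).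
have e10 : 0 < e1 by rewrite lt_min ltr01 powR_gt0.
have : \forall t \near \oo, `|0 - gamma t `^ q| < e1 `^ q.
  by move/cvgrPdist_lt : gammaq_cvg; apply; rewrite powR_gt0.
apply: filterS => t; rewrite sub0r normrN ger0_norm ?powR_ge0// => gt.
have ge1 : gamma t <= e1.
  rewrite leNgt; apply/negP => h; move: gt; rewrite ltNge => /negP; apply.
  by rewrite ge0_ler_powR ?nnegrE ?(ltW q0) ?(ltW e10) ?(ltW h).
have [g1 ge] : gamma t <= 1 /\ gamma t <= e `^ alpha^-1.
  by move: ge1; rewrite /e1 le_min => /andP.
split=> //; apply: (@le_trans _ _ ((e `^ alpha^-1) `^ alpha)).
  by rewrite ge0_ler_powR ?nnegrE ?(ltW a0) ?powR_ge0.
by rewrite -powRrM mulVf ?gt_eqF// powRr1// ltW.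
Qed.

Lemma gamma_cvg0 : gamma @ \oo --> (0 : R).
Proof.
apply/cvgrPdist_lt => e e0.
have ea : 0 < (e / 2) `^ alpha by rewrite powR_gt0// divr_gt0.
apply: filterS (gamma_power_small ea) => t [_ gt].
rewrite sub0r normrN ger0_norm//; apply: (@le_lt_trans _ _ (e / 2)); last first.
  by rewrite ltr_pdivrMr// ltr_pMr// ltr1n.
rewrite leNgt; apply/negP => h; move: gt; rewrite leNgt => /negP; apply.
by apply: gt0_ltr_powR => //; rewrite nnegrE// divr_ge0// ltW.
Qed.

Section direction.
Variables (e : 'rV[R]_d) (c0 : R).

Let K := Hcst alpha beta A + Bcst alpha beta s A + (2 * Bcst alpha beta s A + Ecst beta e) * sigma2.
(** The remaining error budget: adding [K * tail t] to [V] turns the drift inequality with error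
    [K * gamma t] to the power [q] into an exact supermartingale inequality. *)
Let tail t := limn (series (fun t => gamma t `^ q)) - series (fun t => gamma t `^ q) t.
Let V t w := lyapunov f alpha fs e c0 (shifted t w) (momentum t w) (noise t w).
Let W t w := V t w + K * tail t.
Let D t w := gamma t * inv1b beta / 4 * enorm (gradient f (iterate t w)) ^+ 2 +
  (1 - beta) / 2 * enorm (momentum t w) `^ q.

Let b10 : 0 <= 1 - beta. Proof. by rewrite subr_ge0; case/andP: hbeta => _ /ltW. Qed.
Let ib0 : 0 <= inv1b beta. Proof. by rewrite invr_ge0. Qed.
Let B0 : 0 <= Bcst alpha beta s A.
Proof. by rewrite /Bcst addr_ge0// mulr_ge0 ?powR_ge0// ltW. Qed.
Let E0 : 0 <= Ecst beta e. Proof. exact: sqr_ge0. Qed.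
Let H0 : 0 <= Hcst alpha beta A.
Proof. by rewrite /Hcst mulr_ge0 ?sqr_ge0// divr_ge0. Qed.
Let K0 : 0 <= K.
Proof.
have E1 : 0 <= 2 * Bcst alpha beta s A + Ecst beta e by rewrite addr_ge0// mulr_ge0.
by rewrite /K addr_ge0 ?mulr_ge0// addr_ge0.
Qed.
Let tail0 t : 0 <= tail t.
Proof.
rewrite subr_ge0; apply: nondecreasing_cvgn_le gammaq t.
by apply/nondecreasing_seqP => n; rewrite seriesSr lerDl powR_ge0.
Qed.
Let tailS t : tail t = gamma t `^ q + tail t.+1.
Proof. by rewrite /tail seriesSr; ring. Qed.
Let tail_cvg0 : tail @ \oo --> (0 : R).
Proof.
rewrite -[X in _ --> X](subrr (limn (series (fun t => gamma t `^ q)))).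
by apply: cvgB => //; exact: cvg_cst.
Qed.
Let V0 t w : 0 <= V t w.
Proof. by rewrite /V /lyapunov addr_ge0 ?sqr_ge0// addr_ge0 ?powR_ge0// subr_ge0. Qed.
Let W0 t w : 0 <= W t w.
Proof. by rewrite /W addr_ge0// mulr_ge0. Qed.
Let D0 t w : 0 <= D t w.
Proof.
by rewrite /D addr_ge0// mulr_ge0 ?sqr_ge0 ?powR_ge0// ?divr_ge0// mulr_ge0.
Qed.

Let measurable_lyapunov {dT} {T : measurableType dT} (u m n : T -> 'rV[R]_d) :
  row_measurable u -> row_measurable m -> row_measurable n ->
  measurable_fun [set: T] (fun w => lyapunov f alpha fs e c0 (u w) (m w) (n w)).
Proof.
move=> mu mm mn; have cf : continuous f by move=> y; exact: differentiable_continuous.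
apply: measurable_funD; first apply: measurable_funD.
- by apply: measurable_funB => //; exact: (measurable_continuous_row cf mu).
- apply: (measurableT_comp (measurable_powR q)).
  exact: (measurable_continuous_row continuous_enorm mm).
- apply: measurable_funX; apply: measurable_funD => //.
  apply: measurable_sum => i; apply: measurable_funM => //; exact: mn.
Qed.

Let mD {dT} {T : measurableType dT} t (x m : T -> 'rV[R]_d) :
  row_measurable x -> row_measurable m ->
  measurable_fun [set: T] (fun w => gamma t * inv1b beta / 4 * enorm (gradient f (x w)) ^+ 2 +
  (1 - beta) / 2 * enorm (m w) `^ q).
Proof.
move=> mx mm; apply: measurable_funD; apply: measurable_funM => //.
  apply: measurable_funX.
  exact: (measurable_continuous_row continuous_enorm (row_measurable_continuous cg mx)).
apply: (measurableT_comp (measurable_powR q)).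
exact: (measurable_continuous_row continuous_enorm mm).
Qed.

(** The pointwise bound, averaged over the fresh noise with the past frozen, gives the
    supermartingale inequality from the time [T0] on at which the steps are small; [tail] tends to
    0, so [V] converges with [W]. *)
Lemma direction_cvg :
  {ae P, forall w, cvgn (V ^~ w) /\ cvgn (series (D ^~ w))}.
Proof.
have b1' : 0 < 1 - beta by rewrite lt0r b1.
pose L := 2 * Bcst alpha beta s A + (2 * Bcst alpha beta s A + Ecst beta e) * C.
have L0 : 0 <= L by rewrite addr_ge0 ?mulr_ge0// addr_ge0// mulr_ge0.
(* Thresholds for the two smallness conditions of [lyapunov_drift]; the [+ 1] avoids division by
   zero. *)
pose e1 := (1 - beta) / 2 / (Hcst alpha beta A + 1).
pose e2 := inv1b beta / 4 / (L + 1).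
have e10 : 0 < e1 by rewrite !divr_gt0// ltr_wpDl.
have e20 : 0 < e2 by rewrite !divr_gt0 ?invr_gt0// ltr_wpDl.
have e120 : 0 < Num.min e1 e2 by rewrite lt_min e10.
have [T0 _ HT0] := gamma_power_small e120.
have small (M r x : R) : 0 <= M -> x <= r / (M + 1) -> 0 <= x -> M * x <= r.
  move=> M0 xr xge; have M1 : 0 < M + 1 by rewrite ltr_wpDl.
  by move: xr; rewrite ler_pdivlMr//; lra.
have decr t (B : set Omega) : (T0 <= t)%N -> @measurable _ (FT t) B ->
    (\int[P]_(w in B) (W t.+1 w + D t w)%:E <= \int[P]_(w in B) (W t w)%:E)%E.
  move=> T0t mB; have [g1] := HT0 t T0t; rewrite le_min => /andP[ge1 ge2].
  have g01 : 0 <= gamma t <= 1 by rewrite gamma0.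
  (* [W t.+1 + D t] as a function of the past and of the fresh sample separately, the form that
     [freezing] requires. *)
  pose hr (p : FT t * X) : R := lyapunov f alpha fs e c0
    (shifted t p.1 - (gamma t * inv1b beta) *: g (iterate t p.1) p.2)
    (beta *: momentum t p.1 + (kick beta s * gamma t) *: g (iterate t p.1) p.2)
    (noise t p.1 + (gamma t * inv1b beta) *:
      (g (iterate t p.1) p.2 - gradient f (iterate t p.1))) +
    (K * tail t.+1 + D t p.1).
  pose h p := (hr p)%:E.
  have hE w : h (w, xi t w) = (W t.+1 w + D t w)%:E.
    by rewrite /h /hr /W /V /= shiftedS momentumS noiseS addrA.
  under eq_integral do rewrite -hE.
  have lyap0 u m n : 0 <= lyapunov f alpha fs e c0 u m n.
    by rewrite /lyapunov addr_ge0 ?sqr_ge0// addr_ge0 ?powR_ge0// subr_ge0.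
  have mx := row_measurable_comp (@iterate_measurable t) (@measurable_fst _ _ (FT t) X).
  have mm := row_measurable_comp (@momentum_measurable t) (@measurable_fst _ _ (FT t) X).
  have mu := row_measurable_comp (@shifted_measurable t) (@measurable_fst _ _ (FT t) X).
  have mn := row_measurable_comp (@noise_measurable t) (@measurable_fst _ _ (FT t) X).
  have mq := oracle_measurable hg mx (@measurable_snd _ _ (FT t) X).
  have mG := row_measurable_continuous cg mx.
  apply: (@freezing _ _ _ _ _ P (xi t) (history xi t) (@history_measurable _ _ _ _ _ P xi t)
    (@history_independent _ _ _ _ _ P xi indep t) h (fun w => (W t w)%:E)) => //.
  - apply/measurable_EFinP; rewrite /hr; apply: measurable_funD.
      apply: measurable_lyapunov.
      + exact: (row_measurableB mu (row_measurableZ _ mq)).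
      + exact: (row_measurableD (row_measurableZ _ mm) (row_measurableZ _ mq)).
      + exact: (row_measurableD mn (row_measurableZ _ (row_measurableB mq mG))).
    by apply: measurable_funD => //; exact: mD mx mm.
  - move=> p; rewrite /h /hr lee_fin; apply: addr_ge0; first exact: lyap0.
    by apply: addr_ge0; [exact: mulr_ge0|exact: D0].
  - apply/measurable_EFinP; apply: (measurable_coarser (@history_measurable _ _ _ _ _ P xi t)).
    apply: measurable_funD => //.
    exact: (measurable_lyapunov (@shifted_measurable t) (@momentum_measurable t) (@noise_measurable t)).
  move=> w; set x := iterate t w.
  have c10 : 0 <= 2 * Bcst alpha beta s A * gamma t `^ q + Ecst beta e * gamma t ^+ 2.
    apply: addr_ge0; first by rewrite mulr_ge0 ?powR_ge0// mulr_ge0.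
    by rewrite mulr_ge0// sqr_ge0.
  have drift := lyapunov_drift fs halpha hbeta A0 holder c0 (noise t w) sigma20 C0 g01
    (shifted_iterate t w) (small _ _ _ H0 ge1 (powR_ge0 _ _)) (small _ _ _ L0 ge2 (powR_ge0 _ _)).
  have point z := lyapunov_pointwise s fs halpha hbeta A0 df holder e c0 (shifted t w)
    (momentum t w) (noise t w) (g x z) (gradient f x) (gamma0 t).
  apply: le_trans (oracle_expectation_le hg hunb hvar (t := t) (x := x)
    (h := fun w' => hr (w, xi t w')) (c1 := 2 * Bcst alpha beta s A * gamma t `^ q + Ecst beta e * gamma t ^+ 2)
    (a := f (shifted t w) - fs - gamma t * inv1b beta * dotp (gradient f (shifted t w)) (gradient f x) +
      beta * enorm (momentum t w) `^ q + (dotp e (noise t w) + c0) ^+ 2 +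
      Bcst alpha beta s A * gamma t `^ q * (1 + 2 * enorm (gradient f x) ^+ 2) + (K * tail t.+1 + D t w))
    (p := - (gamma t * inv1b beta) *: gradient f (shifted t w) +
      (2 * (gamma t * inv1b beta) * (dotp e (noise t w) + c0)) *: e) _ _ c10 _) _.
  - have mqx : row_measurable (fun w' => g x (xi t w')).
      by apply: (oracle_measurable hg (row_measurable_cst x)); exact: measurable_funP.
    rewrite /hr /=; apply: measurable_funD => //; apply: measurable_lyapunov.
    + exact: (row_measurableB (row_measurable_cst _) (row_measurableZ _ mqx)).
    + exact: (row_measurableD (row_measurable_cst _) (row_measurableZ _ mqx)).
    + exact: (row_measurableD (row_measurable_cst _)
        (row_measurableZ _ (row_measurableB mqx (row_measurable_cst _)))).
  - move=> w'; rewrite /hr /=; apply: addr_ge0; first exact: lyap0.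
    by apply: addr_ge0; [exact: mulr_ge0|exact: D0].
  - move=> w'; rewrite /hr /= -/x; have := point (xi t w').
    move=> pt; apply: le_trans (lerD pt (lexx (K * tail t.+1 + D t w))) _.
    by rewrite le_eqVlt; apply/orP; left; apply/eqP; ring.
  rewrite lee_fin /W /V; move: drift; rewrite -/K -/(D t w) -/x => dr.
  apply: (le_trans _ (le_trans (lerD dr (lexx (K * tail t.+1))) _)).
    by rewrite le_eqVlt; apply/orP; left; apply/eqP; ring.
  by rewrite (tailS t) (mulrDr K (gamma t `^ q)) addrA.
have FS n : history xi (n + T0)%N `<=` history xi (n.+1 + T0)%N by exact: history_nondecreasing.
have mW t : measurable_fun [set: FT t] (W t : FT t -> R).
  apply: measurable_funD => //.
  exact: (measurable_lyapunov (@shifted_measurable t) (@momentum_measurable t) (@noise_measurable t)).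
have mDT t : measurable_fun [set: Omega] (D t).
  apply: (measurable_coarser (@history_measurable _ _ _ _ _ P xi t)).
  exact: (mD t (@iterate_measurable t) (@momentum_measurable t)).
have := @supermartingale_cvg _ _ _ P (fun n => history xi (n + T0)%N)
  (fun n => @history_measurable _ _ _ _ _ P xi (n + T0)%N) FS
  (fun n => W (n + T0)%N) (fun n => D (n + T0)%N) (fun n => W0 _) (fun n => D0 _)
  (fun n => mW _) (fun n => mDT _) (fun n B => decr _ B (leq_addl _ _)).
apply: filterS => w [cW cD]; split.
  have cWw : cvgn (W ^~ w).
    by move/cvg_ex: cW => [l cl]; apply/cvg_ex; exists l; rewrite -(cvg_shiftn T0).
  rewrite (_ : V ^~ w = (W ^~ w) - (fun t => K * tail t)).
    apply: is_cvgB => //; apply: is_cvgMr; apply/cvg_ex; exists 0; exact: tail_cvg0.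
  by apply/funext => t; rewrite /W /= !fctE addrK.
exact: (@cvgn_series_shift _ (D ^~ w) T0 cD).
Qed.

End direction.
End process.

(** * Analysis of a single realization *)

Section path.
Context {R : realType} {d : nat} (f : 'rV[R]_d -> R) (alpha beta A fs : R).
Hypotheses (halpha : 0 < alpha <= 1) (hbeta : 0 <= beta < 1) (A0 : 0 < A).
Hypothesis df : forall x, differentiable f x.
Hypothesis holder : forall x y,
  enorm (gradient f x - gradient f y) <= A * enorm (x - y) `^ alpha.
Variables (u m n x : nat -> 'rV[R]_d) (eta : nat -> R).
Hypothesis eta0 : forall t, 0 <= eta t.
Hypothesis eta_cvg0 : eta @ \oo --> (0 : R).
Hypothesis eta_oo : ~ cvgn (series eta).
Hypothesis un : forall t, u t.+1 + n t.+1 = u t + n t - eta t *: gradient f (x t).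
Hypothesis ux : forall t, u t - x t = lag beta *: m t.
Local Notation q := (1 + alpha).
Hypothesis lyap_cvg : cvgn (fun t => lyapunov f alpha fs 0 0 (u t) (m t) (n t)).
Hypothesis lyap_cvg0 : forall i,
  cvgn (fun t => lyapunov f alpha fs (delta_mx 0 i) 0 (u t) (m t) (n t)).
Hypothesis lyap_cvg1 : forall i,
  cvgn (fun t => lyapunov f alpha fs (delta_mx 0 i) 1 (u t) (m t) (n t)).
Hypothesis drift_cvg : cvgn (series (fun t =>
  eta t / 4 * enorm (gradient f (x t)) ^+ 2 + (1 - beta) / 2 * enorm (m t) `^ q)).

Let a0 : 0 < alpha. Proof. by case/andP: halpha. Qed.
Let b1 : 0 < 1 - beta. Proof. by rewrite subr_gt0; case/andP: hbeta. Qed.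
Let q0 : 0 < q. Proof. by rewrite addr_gt0. Qed.
Let lag0 : 0 <= lag beta.
Proof. by rewrite /lag /inv1b mulr_ge0 ?invr_ge0 ?(ltW b1)//; case/andP: hbeta. Qed.

Let squeeze0 (a b : nat -> R) : (forall t, 0 <= a t <= b t) ->
  b @ \oo --> (0 : R) -> a @ \oo --> (0 : R).
Proof.
move=> ab b0; apply: (@squeeze_cvgr _ _ _ _ (cst 0) b) => //; last exact: cvg_cst.
by apply: nearW => t; exact: ab.
Qed.

Let drift_parts t : 0 <= eta t / 4 * enorm (gradient f (x t)) ^+ 2 /\
  0 <= (1 - beta) / 2 * enorm (m t) `^ q.
Proof.
by split; rewrite mulr_ge0 ?sqr_ge0 ?powR_ge0// divr_ge0// ltW.
Qed.

Let scale0 (k : R) (b : nat -> R) :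
  b @ \oo --> (0 : R) -> (fun t => k * b t) @ \oo --> (0 : R).
Proof. by move=> b0; rewrite -[X in _ --> X](mulr0 k); exact: cvgMl_tmp. Qed.

Let mq_cvg0 : (fun t => enorm (m t) `^ q) @ \oo --> (0 : R).
Proof.
have H := cvg_series_cvg_0 drift_cvg.
have := scale0 (2 / (1 - beta)) H; apply: squeeze0 => t; rewrite powR_ge0 /=.
have [h1 h2] := drift_parts t.
rewrite [leLHS](_ : _ = 2 / (1 - beta) * ((1 - beta) / 2 * enorm (m t) `^ q)); last first.
  by field; rewrite gt_eqF.
apply: ler_wpM2l; first by rewrite divr_ge0// ltW.
by rewrite /= lerDr.
Qed.

Let m_cvg0 : (fun t => enorm (m t)) @ \oo --> (0 : R).
Proof.
apply/cvgrPdist_lt => e e0; have eq0 : 0 < e `^ q by rewrite powR_gt0.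
have : \forall t \near \oo, `|0 - enorm (m t) `^ q| < e `^ q.
  by move/cvgrPdist_lt : mq_cvg0; exact.
apply: filterS => t; rewrite !sub0r !normrN !ger0_norm ?powR_ge0 ?enorm_ge0// => mt.
rewrite ltNge; apply/negP => h; move: mt; rewrite ltNge => /negP; apply.
by rewrite ge0_ler_powR ?nnegrE ?enorm_ge0 ?(ltW q0) ?(ltW e0).
Qed.

Let ux_cvg0 : (fun t => enorm (u t - x t)) @ \oo --> (0 : R).
Proof.
under eq_fun do rewrite ux enormZ (ger0_norm lag0).
exact: scale0.
Qed.

(** The difference of the Lyapunov functions with constants 1 and 0 is
    [(n_i + 1)^2 - n_i^2 = 2 n_i + 1]. *)
Let n_cvg i : cvgn (fun t => n t 0 i).
Proof.
have dotE t : dotp (delta_mx 0 i) (n t) = n t 0 i.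
  rewrite /dotp (bigD1 i)//= big1 => [|j ji]; first by rewrite mxE !eqxx mul1r addr0.
  by rewrite mxE (negbTE ji) andbF mul0r.
have /cvg_ex[l1 h1] := @lyap_cvg1 i.
have /cvg_ex[l0 h0] := @lyap_cvg0 i.
apply/cvg_ex; exists (2^-1 * (l1 - l0 - 1)).
rewrite (_ : (fun t => n t 0 i) = fun t => 2^-1 *
  (lyapunov f alpha fs (delta_mx 0 i) 1 (u t) (m t) (n t) -
   lyapunov f alpha fs (delta_mx 0 i) 0 (u t) (m t) (n t) - 1)); last first.
  by apply/funext => t; rewrite /lyapunov dotE; field.
apply: cvgMl_tmp; apply: cvgB; last exact: cvg_cst.
exact: (cvgB h1 h0).
Qed.

Let ninf := \row_i limn (fun t => n t 0 i).

Let n_cvg0 : (fun t => enorm (n t - ninf)) @ \oo --> (0 : R).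
Proof.
have H : (fun t => \sum_(i < d) `|n t 0 i - limn (fun t => n t 0 i)|) @ \oo --> (0 : R).
  rewrite -[X in _ --> X](_ : \sum_(i < d) 0 = 0); last by rewrite big1.
  apply: cvg_big => [|i _]; first exact: add_continuous.
  by apply/norm_cvg0P/subr_cvg0; exact: n_cvg.
apply: squeeze0 H => t; rewrite enorm_ge0/=.
rewrite {1}(row_sum_delta (n t - ninf)); apply: le_trans (enorm_sum _ _) _.
apply: ler_sum => i _; rewrite enormZ !mxE.
rewrite [X in _ * X](_ : _ = 1) ?mulr1// /enorm (bigD1 i)//= big1 => [|j ji].
  by rewrite !mxE !eqxx expr1n addr0 sqrtr1.
by rewrite !mxE (negbTE ji) andbF expr0n.
Qed.

(** Adding back the noise still to come makes the recursion noiseless while staying asymptotic to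
    [x]. *)
Let v t := u t + n t - ninf.

Let vx_cvg0 : (fun t => enorm (v t - x t)) @ \oo --> (0 : R).
Proof.
have H : (fun t => enorm (u t - x t) + enorm (n t - ninf)) @ \oo --> (0 : R).
  by rewrite -[X in _ --> X](addr0 0); exact: cvgD.
apply: squeeze0 H => t; rewrite enorm_ge0/=.
have -> : v t - x t = (u t - x t) + (n t - ninf).
  by apply/rowP => i; rewrite /v !mxE; ring.
exact: enormD.
Qed.

Lemma gradient_path_cvg0 : (fun t => enorm (gradient f (x t))) @ \oo --> (0 : R).
Proof.
apply: (gradient_vanishes A0 a0 holder eta0 eta_cvg0 eta_oo (v := v)) => //.
  by move=> t; rewrite /v un addrAC.
have := is_cvg_seriesZ (k := 4) drift_cvg; apply: series_le_cvg => t /=.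
- by rewrite mulr_ge0 ?sqr_ge0.
- by have [h1 h2] := drift_parts t; rewrite mulr_ge0// addr_ge0.
- have [h1 h2] := drift_parts t.
  rewrite -[X in _ <= X]/(4 * (eta t / 4 * enorm (gradient f (x t)) ^+ 2 + (1 - beta) / 2 * enorm (m t) `^ q)).
  move: h2; set b := _ / 2 * _; lra.
Qed.

(** [f (u t)] converges as the Lyapunov value with [e = 0] minus the vanishing momentum term.
    Passing to [f (x t)] uses the Taylor estimate at [x t], where the gradient is already known to
    vanish. *)
Lemma value_path_cvg : cvgn (fun t => f (x t)).
Proof.
have /cvg_ex[l V] := lyap_cvg.
have dot0 w : dotp (0 : 'rV[R]_d) w = 0.
  by rewrite /dotp big1// => i _; rewrite mxE mul0r.
have fu : (fun t => f (u t)) @ \oo --> l - 0 + fs.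
  rewrite (_ : (fun t => f (u t)) = fun t =>
    lyapunov f alpha fs 0 0 (u t) (m t) (n t) - enorm (m t) `^ q + fs); last first.
    by apply/funext => t; rewrite /lyapunov dot0; ring.
  by apply: cvgD; [exact: (cvgB V mq_cvg0)|exact: cvg_cst].
have diff0 : (fun t => f (x t) - f (u t)) @ \oo --> (0 : R).
  apply/norm_cvg0P.
  have b0 : (fun t => enorm (gradient f (x t)) * enorm (u t - x t) +
      A * lag beta `^ q * enorm (m t) `^ q) @ \oo --> (0 : R).
    rewrite -[X in _ --> X](addr0 0); apply: cvgD; last exact: scale0.
    by rewrite -[X in _ --> X](mulr0 0); apply: cvgM; [exact: gradient_path_cvg0|exact: ux_cvg0].
  apply: squeeze0 b0 => t; rewrite normr_ge0/=.
  have := descent df (x t) (u t - x t) (ltW A0) (ltW a0) holder.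
  rewrite subrKC [X in _ <= A * X `^ _](_ : _ = lag beta * enorm (m t)); last first.
    by rewrite ux enormZ ger0_norm.
  rewrite powRM ?enorm_ge0// mulrA => h1.
  have h2 := cauchy_schwarz (gradient f (x t)) (u t - x t).
  rewrite distrC; set dd := dotp _ _ in h1 h2.
  rewrite -(subrK dd (f (u t) - f (x t))); apply: le_trans (ler_normD _ _) _.
  by rewrite addrC lerD.
apply/cvg_ex; exists (0 + (l - 0 + fs)).
rewrite (_ : (fun t => f (x t)) = fun t => f (x t) - f (u t) + f (u t)); last first.
  by apply/funext => t; rewrite subrK.
exact: cvgD.
Qed.

Lemma step_path_cvg0 : (fun t => enorm (x t.+1 - x t)) @ \oo --> (0 : R).
Proof.
have vx1 : (fun t => enorm (v t.+1 - x t.+1)) @ \oo --> (0 : R).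
  by have := vx_cvg0; rewrite -(cvg_shiftS (fun t => enorm (v t - x t))).
have ge : (fun t => eta t * enorm (gradient f (x t))) @ \oo --> (0 : R).
  by rewrite -[X in _ --> X](mulr0 0); apply: cvgM; [exact: eta_cvg0|exact: gradient_path_cvg0].
have H : (fun t => enorm (v t.+1 - x t.+1) + enorm (v t - x t) +
    eta t * enorm (gradient f (x t))) @ \oo --> (0 : R).
  rewrite -[X in _ --> X](addr0 0); apply: cvgD => //.
  by rewrite -[X in _ --> X](addr0 0); exact: cvgD.
apply: squeeze0 H => t; rewrite enorm_ge0/=.
have -> : x t.+1 - x t = - (v t.+1 - x t.+1) + (v t - x t) + - (eta t *: gradient f (x t)).
  rewrite {1}/v un; apply/rowP => i; rewrite /v !mxE; ring.
apply: le_trans (enormD _ _) _; rewrite enormN enormZ (ger0_norm (eta0 t)) lerD2r.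
by apply: le_trans (enormD _ _) _; rewrite enormN.
Qed.

End path.

(** * Assembly of the probabilistic and pathwise results *)

Theorem theorem2 (R : realType) (d : nat)
    (dO dX : measure_display)
    (Omega : measurableType dO) (X : measurableType dX)
    (P : probability Omega R)
    (f : 'rV[R]_d -> R)
    (g : 'rV[R]_d -> X -> 'rV[R]_d) (xi : nat -> {RV P >-> X})
    (alpha beta s : R) (gamma : nat -> R) (x0 : 'rV[R]_d)
    (hbeta : 0 <= beta < 1) (hs : 0 <= s) (halpha : 0 < alpha <= 1)
    (hg : borel_oracle g)
    (hC1 : continuously_differentiable f) (hinf : bounded_below f)
    (hholder : holder_gradient f alpha)
    (hunbiased : unbiased g xi f)
    (hvar : affine_variance g xi f)
    (hindep : mutually_independent xi)
    (hgamma : stepsizes alpha gamma) :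
  let x := fun (t : nat) (w : Omega) =>
    sum_iterate g beta s gamma x0 (fun k => xi k w) t in
  [/\ {ae P, forall w, cvgn (fun t => f (x t w))},
      {ae P, forall w,
        (fun t => gradient f (x t w)) @ \oo --> (0 : 'rV[R]_d)} &
      finitely_many_critical_points f -> coercive f ->
        {ae P, forall w, cvgn (fun t => x t w)}].
Proof.
move=> x; have [df cg] := hC1.
have [fs fsf] : exists fs, forall y, fs <= f y.
  move: hinf; rewrite /bounded_below.
  have lb y : (ereal_inf [set (f y)%:E | y in [set: 'rV[R]_d]] <= (f y)%:E)%E.
    by apply: ereal_inf_lbound; exists y.
  case: (ereal_inf _) lb => [r lb _|/(_ 0)|_]; last by rewrite ltxx.
    by exists r => y; rewrite -lee_fin.
  by rewrite leye_eq.
have [A [A0 holder]] := hholder.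
have [sigma2 [C [/ltW s20 /ltW C0 hv]]] := hvar.
have [g0 _ _] := hgamma; have [goo gq] := stepsizes_series hgamma.
have dir e c0 := direction_cvg s x0 hg cg hbeta halpha df hunbiased hindep s20 C0 A0
  fsf hv holder g0 gq e c0.
have ib0 : 0 < inv1b beta by rewrite invr_gt0 subr_gt0; case/andP: hbeta.
pose eta t := gamma t * inv1b beta.
have eta0 t : 0 <= eta t by rewrite mulr_ge0// ltW.
have eta_cvg0 : eta @ \oo --> (0 : R).
  by rewrite -[X in _ --> X](mul0r (inv1b beta)); apply: cvgMr_tmp; exact: gamma_cvg0 halpha g0 gq.
have eta_oo : ~ cvgn (series eta).
  move=> /(is_cvg_seriesZ (k := (inv1b beta)^-1)) ce; apply: goo; move: ce.
  rewrite (_ : _ *: eta = gamma)//; apply/funext => t.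
  by rewrite /eta fctE [_ *: _]mulrC mulfK// gt_eqF.
have main : {ae P, forall w,
    [/\ cvgn (fun t => f (x t w)),
        (fun t => enorm (gradient f (x t w))) @ \oo --> (0 : R) &
        (fun t => enorm (x t.+1 w - x t w)) @ \oo --> (0 : R)]}.
  have FP : Filter (almost_everywhere P) by exact: _.
  (* Finitely many directions, so the exceptional null sets can be merged. *)
  have all1 := filter_forall FP (fun i => dir (delta_mx 0 i) 1).
  have all0 := filter_forall FP (fun i => dir (delta_mx 0 i) 0).
  move: (dir 0 0) all0 all1; apply: filterS3 => w [c00 cD] c0 c1.
  have un t : shifted g xi beta s gamma x0 t.+1 w + noise f g xi beta s gamma x0 t.+1 w =
      shifted g xi beta s gamma x0 t w + noise f g xi beta s gamma x0 t w -
      eta t *: gradient f (x t w).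
    have alg (y a b c : 'rV[R]_d) : y - a + (b + (a - c)) = y + b - c.
      by apply/rowP => i; rewrite !mxE; ring.
    by rewrite (shiftedS _ _ _ _ _ hbeta) noiseS scalerBr alg.
  have ux t := shifted_iterate g xi s gamma x0 hbeta t w.
  have c0' i := (c0 i).1.
  have c1' i := (c1 i).1.
  split.
  - exact: (value_path_cvg halpha hbeta A0 df holder eta0 eta_cvg0 eta_oo un ux c00 c0' c1' cD).
  - exact: (gradient_path_cvg0 halpha hbeta A0 holder eta0 eta_cvg0 eta_oo un ux c0' c1' cD).
  - exact: (step_path_cvg0 halpha hbeta A0 holder eta0 eta_cvg0 eta_oo un ux c0' c1' cD).
split.
- by apply: filterS main => w [].
- by apply: filterS main => w [_ gx _]; exact/cvg_enorm0.
move=> fin coer; apply: filterS main => w [/cvg_ex[l fx] gx dx].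
have cf : continuous f by move=> y; exact: differentiable_continuous.
exact: (@iterates_converge _ _ f cf cg fin coer (fun t => x t w) l fx gx dx).
Qed.
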